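(* Let $q,a,b,k$ be nonzero complex numbers with $|q|<1$, such that no zero factor occurs in any denominator below (including the denominators of the terms of the series) and all the series below converge absolutely. Then $$\frac{(qab/k,kq/b;q)_\infty\,(q,k^2q/a,q^2a,q^2a^2/k^2;q^2)_\infty}{(kq,qa/k;q)_\infty}\;{}_{8}W_{7}\left(k;\frac{k^2}{ab},b,\frac{qa}{k},\frac{k}{\sqrt{a}},\frac{-k}{\sqrt{a}};\,q,\,\frac{-qa}{k}\right)$$ $$=\left(\frac{k^2q}{ab},bq,\frac{a^2bq^2}{k^2},\frac{q^2a}{b};q^2\right)_\infty {}_{4}\phi_{3}\left[\begin{matrix}\frac{k^2}{ab},\,b,\,\frac{qa^2}{k^2},\,\frac{q^2a^2}{k^2}\\ \frac{q^2a^2b}{k^2},\,\frac{q^2a}{b},\,q\end{matrix};q^2,q^2\right]$$ $$-q\,\frac{\left(1-\frac{qa^2}{k^2}\right)}{(1-q)}\left(\frac{k^2}{ab},b,\frac{a^2bq^3}{k^2},\frac{q^3a}{b};q^2\right)_\infty {}_{4}\phi_{3}\left[\begin{matrix}\frac{k^2q}{ab},\,bq,\,\frac{q^2a^2}{k^2},\,\frac{q^3a^2}{k^2}\\ \frac{q^3a^2b}{k^2},\,\frac{q^3a}{b},\,q^3\end{matrix};q^2,q^2\right].$$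
   Context: Notation: $(x;q)_0=1$, $(x;q)_n=\prod_{j=0}^{n-1}(1-xq^j)$, $(x;q)_\infty=\prod_{j\ge 0}(1-xq^j)$, and $(x_1,\dots,x_m;q)_n=(x_1;q)_n\cdots(x_m;q)_n$ for $n$ a nonnegative integer or $\infty$. In expressions such as $k^2/ab$ the whole product after the slash is the denominator. Basic hypergeometric series with base $p$ (here $p=q^2$): $${}_{r+1}\phi_r\left[\begin{matrix}a_1,\dots,a_{r+1}\\ b_1,\dots,b_r\end{matrix};p,x\right]=\sum_{n=0}^{\infty}\frac{(a_1,\dots,a_{r+1};p)_n}{(p,b_1,\dots,b_r;p)_n}x^n .$$ The very-well-poised series is $${}_{r+1}W_{r}(a_1;a_4,\dots,a_{r+1};q,x)=\sum_{n=0}^{\infty}\frac{(a_1,q\sqrt{a_1},-q\sqrt{a_1},a_4,\dots,a_{r+1};q)_n}{(q,\sqrt{a_1},-\sqrt{a_1},\frac{a_1q}{a_4},\dots,\frac{a_1q}{a_{r+1}};q)_n}\,x^n .$$ Square roots denote fixed choices of complex square root; each occurs together with its negative, so the choice is immaterial. *)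

(* Defs.v *)
From mathcomp Require Export all_boot all_order all_algebra.
From mathcomp Require Export all_classical all_reals all_analysis.
From mathcomp Require Export complex.
Export Order.TTheory GRing.Theory Num.Theory numFieldNormedType.Exports.

Set Implicit Arguments.
Unset Strict Implicit.
Unset Printing Implicit Defensive.

Local Open Scope classical_set_scope.
Local Open Scope complex_scope.
Local Open Scope ring_scope.

Section BasicHypergeometric.
Variable R : realType.
Implicit Types (p q x a s : R[i]) (xs num den params : seq R[i]).

Definition qpoch x q (n : nat) : R[i] := \prod_(j < n) (1 - x * q ^+ j).

(* The cast to R[i]^o gives the topology induced by the complex modulus. *)
Definition qpoch_inf x q : R[i] := limn (fun n => qpoch x q n : R[i]^o).

Definition qpochs xs q (n : nat) : R[i] := \prod_(x <- xs) qpoch x q n.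

Definition qpochs_inf xs q : R[i] := \prod_(x <- xs) qpoch_inf x q.

(* No factor of (x; q)_n, for any x in xs and any n (or n = oo), is zero. *)
Definition no_zero_factor xs q : Prop :=
  forall x, x \in xs -> forall j : nat, 1 - x * q ^+ j != 0.

(* In the series r+1 phi r, size num = r + 1 and size den = r; the factor
   (p; p)_n of the denominator is supplied by phi_term, not by den. *)
Definition phi_term num den p x (n : nat) : R[i]^o :=
  qpochs num p n / qpochs (p :: den) p n * x ^+ n.

Definition phi num den p x : R[i] := limn (series (phi_term num den p x)).

Definition phi_well_defined num den p x : Prop :=
  no_zero_factor (p :: den) p /\ cvgn [normed series (phi_term num den p x)].

(* Very-well-poised series: a is the leading parameter, s is the chosen square
   root of a, and params lists the remaining parameters a_4, ..., a_(r+1). *)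
Definition W_num a s params q : seq R[i] :=
  [:: a, q * s, - (q * s) & params].

Definition W_den a s params q : seq R[i] :=
  [:: s, - s & [seq a * q / c | c <- params]].

Definition W a s params q x : R[i] :=
  phi (W_num a s params q) (W_den a s params q) q x.

Definition W_well_defined a s params q x : Prop :=
  phi_well_defined (W_num a s params q) (W_den a s params q) q x.

End BasicHypergeometric.

(* Main.v *)
Require Import Defs.
From mathcomp Require Import ring lra.

Set Implicit Arguments.
Unset Strict Implicit.
Unset Printing Implicit Defensive.

Local Open Scope classical_set_scope.
Local Open Scope complex_scope.
Local Open Scope ring_scope.

(** Put l = a/k, c = k^2/(ab) and t = bc, so that k = l t and a = l^2 t.  Then
    both sides are single series that are symmetric in b and c.  The two 4phi3
    series are the terms with even and with odd m of
      G(b,c) = sum_m (q l^2;q)_m / (q;q)_m (-q)^m H_m(b) H_m(c),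
      H_m(b) = (b;q)_m (b q^(m+1), l^2 b q^(m+2); q^2)_oo,
    and the left-hand side is K E(b,c), where K depends on q and l only and
      E(b,c) = sum_n (q l;q)_n / (q;q)_n (-q l)^n S_n(t) L_n(b) L_n(c),
      L_n(b) = (b;q)_n (l b q^(n+1);q)_oo
    ([phi_value], [W_value], [lhs_prefactorE]).

    With l fixed, D = G and D = E both satisfy the q-difference equation
      D(b,c) = (1 - l^2 q)(1 - b c q) D(bq,cq)
               + l^2 q (1 - bq)^2 (1 - cq)^2 D(bq^2,cq^2),
    because for each series the corresponding combination of the summands is a
    difference T(n+1) - T(n) of an explicit sequence ([phi_telescope],
    [W_telescope]).

    Suppose |q l| < 1, and let d_N be the value of K E - G at (b q^N, c q^N).
    As N grows both series tend to sums given by the q-binomial theorem, and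
    these agree after multiplication by K ([W_const_limit]); so d_N = O(|q|^N).
    The equation has the limiting form
    (1 - T)(1 + l^2 q T) d = 0 with T the shift N -> N+1, whose solutions behave
    like constants and like (-1/(l^2 q))^N.  Neither is O(|q|^N), since
    |l^2 q^2| < 1, hence d = 0 ([recurrence_unique], [identity_nonterminating]).

    If neither b nor c is of the form q^(-j), the n-th term of the very-well-poised
    series is (-q l)^n times a sequence with a nonzero limit, so its convergence
    forces |q l| < 1.  If b = q^(-N) the series terminates and l is arbitrary;
    then the q-difference equation gives an induction on N, which starts at
    b = 1, where only the first terms survive, and where the factor (1 - bq)^2
    removes the second shift when N = 1 ([identity_terminating]). *)

(** * Complex modulus and limits *)

(** The norm of R[i] takes its values in R[i]; estimates are made with this
    R-valued version, for which real arithmetic and real limits are available. *)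
Definition cmod (R : realType) (z : R[i]) : R := ComplexField.Normc.normc z.

(** Convergence through the real sequence of distances; it is the convergence
    of the topology on R[i]^o by [tends_cvg] and [cvg_tends]. *)
Definition tends (R : realType) (u : nat -> R[i]) (l : R[i]) : Prop :=
  (fun n => cmod (u n - l)) @ \oo --> (0 : R).

Section Modulus.
Variable R : realType.
Implicit Types x y z : R[i].

Lemma normE z : `|z| = (cmod z)%:C.
Proof. by rewrite normc_def /cmod; case: z => a b; reflexivity. Qed.

Lemma cmod_ge0 z : 0 <= cmod z.
Proof. by rewrite -lecR -normE; exact: (normr_ge0 z). Qed.

Lemma cmod0 : cmod 0 = 0 :> R. Proof. exact: ComplexField.Normc.normc0. Qed.

Lemma cmod1 : cmod 1 = 1 :> R. Proof. exact: ComplexField.Normc.normc1. Qed.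

Lemma cmodM x y : cmod (x * y) = cmod x * cmod y.
Proof. exact: ComplexField.Normc.normcM. Qed.

Lemma cmodN x : cmod (- x) = cmod x.
Proof. by apply: complexI; rewrite -!normE normrN. Qed.

Lemma cmodV x : cmod x^-1 = (cmod x)^-1.
Proof. exact: ComplexField.Normc.normcV. Qed.

Lemma cmodX x n : cmod (x ^+ n) = cmod x ^+ n.
Proof. by elim: n => [|n IHn]; rewrite ?cmod1 // !exprS cmodM IHn. Qed.

Lemma cmodD x y : cmod (x + y) <= cmod x + cmod y.
Proof. by rewrite -lecR rmorphD /= -!normE ler_normD. Qed.

Lemma cmodB x y : cmod (x - y) <= cmod x + cmod y.
Proof. by rewrite -(cmodN y) cmodD. Qed.

Lemma cmod_eq0 x : (cmod x == 0) = (x == 0).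
Proof. by rewrite -(inj_eq (@complexI R)) -normE /= normr_eq0. Qed.

Lemma cmod_gt0 x : (0 < cmod x) = (x != 0).
Proof. by rewrite lt_def cmod_ge0 andbT cmod_eq0. Qed.

Lemma cmod_lt1 x : (`|x| < 1) = (cmod x < 1).
Proof. by rewrite normE -[1 in LHS]/((1 : R)%:C) ltcR. Qed.

Lemma cmod_Re x : `|complex.Re x| <= cmod x.
Proof. by rewrite -lecR -normE; exact: normc_ge_Re. Qed.

Lemma cmod_Im x : `|complex.Im x| <= cmod x.
Proof.
have := cmod_Re (x * 'i%C).
by rewrite ReiNIm normrN cmodM (_ : cmod 'i%C = 1) ?mulr1 // /cmod /= expr0n
  /= add0r expr1n sqrtr1.
Qed.

Lemma cmod_ReIm x : cmod x <= `|complex.Re x| + `|complex.Im x|.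
Proof.
have cR (a : R) : cmod a%:C = `|a|.
  by rewrite /cmod /= [0 ^+ 2]expr0n /= addr0 sqrtr_sqr.
have ci : cmod ('i%C : R[i]) = 1.
  by rewrite /cmod /= expr0n /= add0r expr1n sqrtr1.
by rewrite {1}[x]complexE (le_trans (cmodD _ _))// cmodM ci mul1r !cR.
Qed.

End Modulus.

Section Limits.
Variable R : realType.
Implicit Types (u v : nat -> R[i]) (l m z : R[i]).

Lemma tendsP u l : tends u l <->
  forall e : R, 0 < e -> exists N, forall n, (N <= n)%N -> cmod (u n - l) < e.
Proof.
split=> [/cvgrPdist_lt ul e e0|ul].
  have [N _ hN] := ul _ e0; exists N => n /hN /=.
  by rewrite sub0r normrN ger0_norm ?cmod_ge0.
apply/cvgrPdist_lt => e e0; have [N hN] := ul _ e0.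
by exists N => //= n /hN; rewrite sub0r normrN ger0_norm ?cmod_ge0.
Qed.

Lemma tends_cvg u l : tends u l -> (u : nat -> R[i]^o) @ \oo --> (l : R[i]^o).
Proof.
move=> /tendsP ul; apply/cvgrPdist_lt => e e0.
have eR : e = (complex.Re e)%:C.
  by rewrite RRe_real // realE (ltW e0).
have e0' : 0 < complex.Re e by rewrite -ltcR -eR.
have [N hN] := ul _ e0'; exists N => //= n /hN.
by rewrite distrC normE eR ltcR.
Qed.

Lemma cvg_tends u l : (u : nat -> R[i]^o) @ \oo --> (l : R[i]^o) -> tends u l.
Proof.
move=> /cvgrPdist_lt ul; apply/tendsP => e e0.
have e0' : 0 < e%:C by rewrite -[0]/((0 : R)%:C) ltcR.
have [N _ hN] := ul _ e0'; exists N => n /hN.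
by rewrite distrC normE ltcR.
Qed.

Lemma tends_lim u l : tends u l -> limn (u : nat -> R[i]^o) = l.
Proof. by move=> /tends_cvg /cvg_lim; apply. Qed.

Lemma tends_squeeze u l (w : nat -> R) :
  (forall n, cmod (u n - l) <= w n) -> w @ \oo --> (0 : R) -> tends u l.
Proof.
move=> uw w0; apply: (squeeze_cvgr _ (@cvg_cst _ _ _ _ _) w0) => //.
by apply: nearW => n; rewrite cmod_ge0 uw.
Qed.

Lemma tends_unique u l m : tends u l -> tends u m -> l = m.
Proof. by move=> /tends_lim <- /tends_lim <-. Qed.

Lemma tends_cst l : tends (fun=> l) l.
Proof. by rewrite /tends subrr cmod0; exact: cvg_cst. Qed.

Lemma eq_tends u v l : u =1 v -> tends u l -> tends v l.
Proof. by move=> /funext ->. Qed.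

Lemma tendsD u v l m :
  tends u l -> tends v m -> tends (fun n => u n + v n) (l + m).
Proof.
move=> ul vm.
have h : (fun n => cmod (u n - l) + cmod (v n - m)) @ \oo --> (0 : R).
  by rewrite -[X in _ --> X]addr0; exact: cvgD ul vm.
by apply: tends_squeeze h => n; rewrite opprD addrACA cmodD.
Qed.

Lemma tendsN u l : tends u l -> tends (fun n => - u n) (- l).
Proof.
by apply: tends_squeeze => n; rewrite -opprD cmodN.
Qed.

Lemma tendsB u v l m :
  tends u l -> tends v m -> tends (fun n => u n - v n) (l - m).
Proof. by move=> ul /tendsN; exact: tendsD. Qed.

Lemma tends_bounded u l : tends u l -> exists B : R, forall n, cmod (u n) <= B.
Proof.
move=> ul.
have /cvg_seq_bounded/pinfty_ex_gt0[M M_gt0 /= uM] : cvgn (fun n => cmod (u n - l)).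
  by apply/cvg_ex; exists 0.
exists (M + cmod l) => n; rewrite -[u n](subrK l) (le_trans (cmodD _ _)) //.
by rewrite lerD2r; have := uM n I; rewrite /= ger0_norm ?cmod_ge0.
Qed.

Lemma tendsM u v l m :
  tends u l -> tends v m -> tends (fun n => u n * v n) (l * m).
Proof.
move=> ul vm; have [B uB] := tends_bounded ul.
have h : (fun n => cmod (u n - l) * cmod m + B * cmod (v n - m)) @ \oo -->
    (0 : R).
  rewrite -[X in _ --> X](_ : 0 * cmod m + B * 0 = 0); last by ring.
  exact: cvgD (cvgM ul (cvg_cst _)) (cvgM (cvg_cst _) vm).
apply: tends_squeeze h => n /=.
rewrite (_ : u n * v n - l * m = (u n - l) * m + u n * (v n - m)); last by ring.
by rewrite (le_trans (cmodD _ _)) // !cmodM lerD // ler_wpM2r ?cmod_ge0.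
Qed.

Lemma tendsZ u l z : tends u l -> tends (fun n => z * u n) (z * l).
Proof. exact: (tendsM (tends_cst z)). Qed.

Lemma tendsV u l : l != 0 -> tends u l -> tends (fun n => (u n)^-1) l^-1.
Proof.
move=> l0 ul; apply: cvg_tends.
by apply: (@cvgV R[i]) => //; exact: tends_cvg.
Qed.

Lemma tends_shift u l p : tends u l -> tends (fun n => u (n + p)%N) l.
Proof.
move=> /tendsP ul; apply/tendsP => e /ul[N hN]; exists N => n Nn.
by apply: hN; rewrite (leq_trans Nn) ?leq_addr.
Qed.

Lemma tends_shiftS u l : tends (fun n => u n.+1) l -> tends u l.
Proof.
move=> /tendsP ul; apply/tendsP => e /ul[N hN]; exists N.+1 => -[//|n] Nn.
exact: hN.
Qed.

Lemma tends_near u l N : (forall n, (N <= n)%N -> u n = l) -> tends u l.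
Proof.
move=> ul; apply/tendsP => e e0; exists N => n /ul ->.
by rewrite subrr cmod0.
Qed.

Lemma tends_expr z : cmod z < 1 -> tends (fun n => z ^+ n) 0.
Proof.
move=> z1; apply: (@tends_squeeze _ _ (fun n => cmod z ^+ n)) => [n|].
  by rewrite subr0 cmodX.
by apply: cvg_expr; rewrite ger0_norm ?cmod_ge0.
Qed.

Lemma tends_le u l (B : R) : tends u l -> (forall n, cmod (u n) <= B) ->
  cmod l <= B.
Proof.
move=> /tendsP ul uB; apply/ler_addgt0Pr => e /ul[N /(_ N (leqnn _))] h.
rewrite -[l](subKr (u N)) (le_trans (cmodB _ _)) // lerD //; exact: ltW.
Qed.

(** Completeness of R[i] enters only here: the real and imaginary parts are
    dominated by a geometric series, hence converge in R. *)
Lemma tends_dominated u (B : R) (r : R) : 0 <= r < 1 ->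
  (forall n, cmod (u n) <= B * r ^+ n) ->
  exists l, tends (series u) l.
Proof.
move=> /andP[r0 r1] uB.
have cg : cvgn (series (geometric B r)).
  by apply: is_cvg_geometric_series; rewrite ger0_norm.
have real_cvg (f : R[i] -> R) : (forall z, `|f z| <= cmod z) ->
    cvgn (series (fun n => f (u n))).
  move=> fle; apply: normed_cvg; apply: (series_le_cvg _ _ _ cg) => n /=.
  - exact: normr_ge0.
  - by rewrite (le_trans (cmod_ge0 (u n))).
  - by rewrite (le_trans (fle _)).
have /cvg_ex[/= a ha] := real_cvg _ (@cmod_Re R).
have /cvg_ex[/= b hb] := real_cvg _ (@cmod_Im R).
exists (a +i* b)%C.
have h : (fun n => `|series (fun n => complex.Re (u n)) n - a| +
    `|series (fun n => complex.Im (u n)) n - b|) @ \oo --> (0 : R).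
  rewrite -[X in _ --> X](_ : `|a - a| + `|b - b| = 0); last first.
    by rewrite !subrr normr0 addr0.
  exact: cvgD (cvg_norm (cvgB ha (cvg_cst a))) (cvg_norm (cvgB hb (cvg_cst b))).
apply: tends_squeeze h => n /=.
rewrite (le_trans (cmod_ReIm _)) //.
by rewrite !raddfB /= /series /= !raddf_sum.
Qed.

(** The error of a whole series from a geometric bound on the error of its
    terms; this turns termwise estimates into estimates of the sums. *)
Lemma series_close u v l m (B r : R) : 0 <= B -> 0 <= r < 1 ->
  (forall n, cmod (u n - v n) <= B * r ^+ n) ->
  tends (series u) l -> tends (series v) m -> cmod (l - m) <= B / (1 - r).
Proof.
move=> B0 /andP[r0 r1] uv ul vm; apply: (tends_le (tendsB ul vm)) => n.
rewrite /series /= -sumrB.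
suff h : cmod (\sum_(0 <= k < n) (u k - v k)) <= B * ((1 - r ^+ n) / (1 - r)).
  apply: (le_trans h); rewrite ler_wpM2l // ler_pdivrMr ?subr_gt0 //.
  by rewrite mulVf ?gt_eqF ?subr_gt0 // lerBlDr lerDl exprn_ge0.
elim: n => [|n IHn]; first by rewrite big_geq // cmod0 expr0 subrr mul0r mulr0.
rewrite big_nat_recr //= (le_trans (cmodD _ _)) //.
have -> : B * ((1 - r ^+ n.+1) / (1 - r)) =
    B * ((1 - r ^+ n) / (1 - r)) + B * r ^+ n.
  by rewrite exprS; field; rewrite gt_eqF ?subr_gt0.
exact: lerD.
Qed.

Lemma tendsM0 u v (B : R) : (forall n, cmod (u n) <= B) -> tends v 0 ->
  tends (fun n => u n * v n) 0.
Proof.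
move=> uB v0.
have h : (fun n => B * cmod (v n - 0)) @ \oo --> (0 : R).
  by rewrite -[X in _ --> X](mulr0 B); exact: cvgM (cvg_cst _) v0.
apply: tends_squeeze h => n; rewrite !subr0 cmodM ler_wpM2r ?cmod_ge0 //.
Qed.

End Limits.

(** * Finite and infinite q-shifted factorials *)

Section FinitePochhammer.
Variable R : realType.
Implicit Types (x q : R[i]) (n m : nat).

Lemma qpoch0 x q : qpoch x q 0 = 1.
Proof. by rewrite /qpoch big_ord0. Qed.

Lemma qpochS x q n : qpoch x q n.+1 = qpoch x q n * (1 - x * q ^+ n).
Proof. by rewrite /qpoch big_ord_recr. Qed.

Lemma qpochSl x q n : qpoch x q n.+1 = (1 - x) * qpoch (x * q) q n.
Proof.
rewrite /qpoch big_ord_recl expr0 mulr1; congr (_ * _).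
by apply: eq_bigr => i _; rewrite exprS mulrA.
Qed.

Lemma qpochD x q m n :
  qpoch x q (m + n) = qpoch x q m * qpoch (x * q ^+ m) q n.
Proof.
elim: n => [|n IHn]; first by rewrite addn0 qpoch0 mulr1.
by rewrite addnS !qpochS IHn exprD !mulrA.
Qed.

Lemma qpoch_neq0 x q n : (forall j, 1 - x * q ^+ j != 0) -> qpoch x q n != 0.
Proof. by move=> h; apply/prodf_neq0 => i _; exact: h. Qed.

Lemma qpoch_eq0 x q j n : 1 - x * q ^+ j = 0 -> (j < n)%N -> qpoch x q n = 0.
Proof.
by move=> h /subnK <-; rewrite addnC qpochD qpochS h mulr0 mul0r.
Qed.

Lemma qpoch_double x q n :
  qpoch x q n.*2 = qpoch x (q ^+ 2) n * qpoch (x * q) (q ^+ 2) n.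
Proof.
elim: n => [|n IHn]; first by rewrite !qpoch0 mulr1.
rewrite doubleS !qpochS IHn -!exprM mul2n (exprS q n.*2).
ring.
Qed.

Lemma qpoch_sqr x q n :
  qpoch (x ^+ 2) (q ^+ 2) n = qpoch x q n * qpoch (- x) q n.
Proof.
elim: n => [|n IHn]; first by rewrite !qpoch0 mulr1.
by rewrite !qpochS IHn -exprM mulnC exprM; ring.
Qed.

End FinitePochhammer.

Section InfinitePochhammer.
Variable R : realType.
Implicit Types (x q : R[i]) (n m : nat).

Lemma qpoch_bound x q n : cmod q < 1 ->
  cmod (qpoch x q n) <= expR (cmod x / (1 - cmod q)).
Proof.
move=> q1; have r0 := cmod_ge0 q; set r := cmod q in q1 r0 *.
have r1 : 0 < 1 - r by lra.
suff h : cmod (qpoch x q n) <= expR (cmod x * ((1 - r ^+ n) / (1 - r))).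
  apply: (le_trans h); rewrite ler_expR ler_wpM2l ?cmod_ge0 //.
  rewrite ler_pdivrMr // mulVf ?gt_eqF // lerBlDr lerDl.
  by rewrite exprn_ge0.
elim: n => [|n IHn].
  by rewrite qpoch0 cmod1 expr0 subrr mul0r mulr0 expR0.
rewrite qpochS cmodM.
have -> : cmod x * ((1 - r ^+ n.+1) / (1 - r)) =
    cmod x * ((1 - r ^+ n) / (1 - r)) + cmod x * r ^+ n.
  by rewrite exprS; field; rewrite gt_eqF.
rewrite expRD ler_pM ?cmod_ge0 // (le_trans (cmodB _ _)) // cmod1.
by rewrite cmodM cmodX expR_ge1Dx.
Qed.

(** The bound is linear in x and uniform in n, so it passes to the infinite
    product and gives the rate at which products tend to 1 as x tends to 0. *)
Lemma qpoch_dist1 x q (c : R) n : cmod q < 1 -> cmod x <= c ->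
  cmod (qpoch x q n - 1) <= cmod x * (expR (c / (1 - cmod q)) / (1 - cmod q)).
Proof.
move=> q1 xc; have r0 := cmod_ge0 q.
have qb m := qpoch_bound x m q1; set r := cmod q in q1 r0 qb *.
have r1 : 0 < 1 - r by lra.
have {}qb m : cmod (qpoch x q m) <= expR (c / (1 - r)).
  by rewrite (le_trans (qb m)) // ler_expR ler_wpM2r // invr_ge0 ltW.
set e := expR _ in qb *; have e0 : 0 < e by exact: expR_gt0.
suff h : cmod (qpoch x q n - 1) <= cmod x * (e * ((1 - r ^+ n) / (1 - r))).
  apply: (le_trans h); rewrite ler_wpM2l ?cmod_ge0 //.
  rewrite ler_wpM2l ?(ltW e0) // -[leRHS]mul1r ler_wpM2r ?invr_ge0 ?(ltW r1) //.
  by rewrite lerBlDr lerDl exprn_ge0.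
elim: n => [|n IHn].
  by rewrite qpoch0 subrr cmod0 expr0 subrr mul0r !mulr0.
rewrite qpochS.
have -> : cmod x * (e * ((1 - r ^+ n.+1) / (1 - r))) =
    cmod x * (e * ((1 - r ^+ n) / (1 - r))) + e * (cmod x * r ^+ n).
  by rewrite exprS; field; rewrite gt_eqF.
rewrite mulrBr mulr1 addrAC (le_trans (cmodB _ _)) // lerD //.
by rewrite !cmodM cmodX ler_wpM2r // mulr_ge0 ?cmod_ge0 // exprn_ge0.
Qed.

(** Consecutive partial products differ by O(|q|^n), so they are the partial
    sums of a geometrically dominated series. *)
Lemma qpoch_tends x q : cmod q < 1 -> tends (qpoch x q) (qpoch_inf x q).
Proof.
move=> q1.
pose u n : R[i] := - qpoch x q n * (x * q ^+ n).
have [l ul] : exists l, tends (series u) l.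
  apply: (@tends_dominated _ _ (expR (cmod x / (1 - cmod q)) * cmod x) (cmod q)).
    by rewrite cmod_ge0.
  move=> n; rewrite /u !cmodM cmodN cmodX mulrA ler_wpM2r ?exprn_ge0 ?cmod_ge0 //.
  by rewrite ler_wpM2r ?cmod_ge0 // qpoch_bound.
have h : tends (qpoch x q) (l + 1).
  apply: eq_tends (tendsD ul (tends_cst 1)) => n.
  elim: n => [|n IHn]; first by rewrite qpoch0 /series /= big_geq // add0r.
  by rewrite seriesSr qpochS -IHn /u -IHn; ring.
by rewrite /qpoch_inf (tends_lim h).
Qed.

Lemma qpoch_inf_split x q n : cmod q < 1 ->
  qpoch_inf x q = qpoch x q n * qpoch_inf (x * q ^+ n) q.
Proof.
move=> q1; apply: (tends_unique (tends_shift n (qpoch_tends x q1))).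
apply: eq_tends (tendsZ (qpoch x q n) (qpoch_tends (x * q ^+ n) q1)) => m.
by rewrite addnC qpochD.
Qed.

Lemma qpoch_infS x q : cmod q < 1 ->
  qpoch_inf x q = (1 - x) * qpoch_inf (x * q) q.
Proof. by move=> q1; rewrite (qpoch_inf_split x 1 q1) qpochS qpoch0 mul1r mulr1. Qed.

Lemma qpoch_inf_dist1 x q (c : R) : cmod q < 1 -> cmod x <= c ->
  cmod (qpoch_inf x q - 1) <= cmod x * (expR (c / (1 - cmod q)) / (1 - cmod q)).
Proof.
move=> q1 xc.
apply: (tends_le (tendsB (qpoch_tends x q1) (tends_cst 1))) => n.
exact: qpoch_dist1.
Qed.

(** After finitely many factors the remaining product is within distance less
    than 1 of 1. *)
Lemma qpoch_inf_neq0 x q : cmod q < 1 -> (forall j, 1 - x * q ^+ j != 0) ->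
  qpoch_inf x q != 0.
Proof.
move=> q1 xq.
pose K := expR (1 / (1 - cmod q)) / (1 - cmod q).
have K0 : 0 < K by rewrite divr_gt0 ?expR_gt0 // subr_gt0.
have /tendsP h : tends (fun n => x * q ^+ n) 0.
  by rewrite -(mulr0 x); exact: tendsZ (tends_expr q1).
have e0 : 0 < Num.min 1 K^-1 by rewrite lt_min ltr01 invr_gt0.
have [N /(_ N (leqnn _))] := h _ e0.
rewrite subr0 lt_min => /andP[h1 h2].
rewrite (qpoch_inf_split x N q1) mulf_neq0 ?qpoch_neq0 //.
apply/negP => /eqP z0.
have := qpoch_inf_dist1 q1 (ltW h1).
rewrite z0 sub0r cmodN cmod1 -/K leNgt => /negP; apply.
by rewrite -ltr_pdivlMr // div1r.
Qed.

Lemma qpoch_inf_double x q : cmod q < 1 ->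
  qpoch_inf x q = qpoch_inf x (q ^+ 2) * qpoch_inf (x * q) (q ^+ 2).
Proof.
move=> q1; have q21 : cmod (q ^+ 2) < 1 by rewrite cmodX exprn_ilt1 ?cmod_ge0.
have /tendsP h := qpoch_tends x q1.
have h2 : tends (fun n => qpoch x q n.*2) (qpoch_inf x q).
  apply/tendsP => e /h[N hN]; exists N => n Nn; apply: hN.
  by rewrite (leq_trans Nn) // -addnn leq_addr.
apply: (tends_unique h2).
apply: eq_tends (tendsM (qpoch_tends x q21) (qpoch_tends (x * q) q21)) => n.
by rewrite qpoch_double.
Qed.

Lemma qpoch_inf_sqr x q : cmod q < 1 ->
  qpoch_inf (x ^+ 2) (q ^+ 2) = qpoch_inf x q * qpoch_inf (- x) q.
Proof.
move=> q1; have q21 : cmod (q ^+ 2) < 1 by rewrite cmodX exprn_ilt1 ?cmod_ge0.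
apply: (tends_unique (qpoch_tends _ q21)).
apply: eq_tends (tendsM (qpoch_tends x q1) (qpoch_tends (- x) q1)) => n.
by rewrite qpoch_sqr.
Qed.

End InfinitePochhammer.

(** * Families that are uniformly close to one *)

(** f N n = 1 + O(r^N) uniformly in n.  Here N counts the shifts of (b,c) and n
    is the summation index; all summands, divided by their value at b = c = 0,
    are of this kind. *)
Definition near_one (R : realType) (r : R) (f : nat -> nat -> R[i]) : Prop :=
  exists B : R, exists N0 : nat, 0 <= B /\
    forall N n, (N0 <= N)%N -> cmod (f N n - 1) <= B * r ^+ N.

Section NearOne.
Variables (R : realType) (r : R).
Hypothesis (r01 : 0 < r < 1).
Implicit Types (f g x : nat -> nat -> R[i]) (p : R[i]).

Lemma near_oneM f g :
  near_one r f -> near_one r g -> near_one r (fun N n => f N n * g N n).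
Proof.
have /andP[r0 r1] := r01.
move=> [Bf [Nf [Bf0 hf]]] [Bg [Ng [Bg0 hg]]].
exists (Bf * (1 + Bg) + Bg), (maxn Nf Ng); split.
  by rewrite addr_ge0 // mulr_ge0 // addr_ge0.
move=> N n; rewrite geq_max => /andP[/(hf _ n) {}hf /(hg _ n) {}hg].
have -> : f N n * g N n - 1 = (f N n - 1) * (1 + (g N n - 1)) + (g N n - 1).
  by ring.
rewrite (le_trans (cmodD _ _)) // [leRHS]mulrDl lerD // cmodM mulrAC.
rewrite ler_pM ?cmod_ge0 // (le_trans (cmodD _ _)) // cmod1 lerD2l.
by rewrite (le_trans hg) // ler_piMr // exprn_ile1 // ltW.
Qed.

Lemma near_oneV f : near_one r f -> near_one r (fun N n => (f N n)^-1).
Proof.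
have /andP[r0 r1] := r01; move=> [B [N0 [B0 h]]].
have /cvgrPdist_lt/(_ (1 / 2))[|N1 _ hN1] : (fun N => B * r ^+ N) @ \oo --> (0 : R).
  by rewrite -[X in _ --> X](mulr0 B); apply: cvgM; [exact: cvg_cst|
    apply: cvg_expr; rewrite ger0_norm // ltW].
  by lra.
exists (2 * B), (maxn N0 N1); split; first by rewrite mulr_ge0.
move=> N n; rewrite geq_max => /andP[/(h _ n) hN /hN1 /=].
rewrite sub0r normrN => /(le_lt_trans (ler_norm _)) hB.
have hf : 1 / 2 <= cmod (f N n).
  have := cmodD (f N n) (- (f N n - 1)); rewrite cmodN opprB addrC subrK cmod1.
  by move: hN hB; set a := cmod _; set b := B * _; set d := cmod _; lra.
have f0 : f N n != 0 by rewrite -cmod_gt0; apply: lt_le_trans hf; lra.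
have -> : (f N n)^-1 - 1 = - (f N n - 1) / f N n by field.
rewrite cmodM cmodN cmodV ler_pdivrMr ?cmod_gt0 // (le_trans hN) //.
rewrite (_ : 2 * B * _ * _ = B * r ^+ N * (2 * cmod (f N n))); last by ring.
by rewrite ler_peMr ?mulr_ge0 ?exprn_ge0 ?(ltW r0) //; lra.
Qed.

Lemma near_one_sub x (c : R) : 0 <= c ->
  (forall N n, cmod (x N n) <= c * r ^+ N) -> near_one r (fun N n => 1 - x N n).
Proof.
move=> c0 h; exists c, 0%N; split=> // N n _.
by rewrite addrAC subrr add0r cmodN.
Qed.

Let bound (c : R) p :
  cmod p < 1 -> 0 <= c -> 0 <= c * (expR (c / (1 - cmod p)) / (1 - cmod p)).
Proof.
by move=> p1 c0; rewrite mulr_ge0 // divr_ge0 ?expR_ge0 // subr_ge0 ltW.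
Qed.

Lemma near_one_qpoch x (c : R) p : cmod p < 1 -> 0 <= c ->
  (forall N n, cmod (x N n) <= c * r ^+ N) ->
  near_one r (fun N n => qpoch (x N n) p n).
Proof.
move=> p1 c0 h; have b0 := bound p1 c0; have /andP[r0 r1] := r01.
exists (c * (expR (c / (1 - cmod p)) / (1 - cmod p))), 0%N; split=> // N n _.
have xc : cmod (x N n) <= c.
  by rewrite (le_trans (h _ _)) // ler_piMr // exprn_ile1 // ltW.
rewrite (le_trans (qpoch_dist1 n p1 xc)) // mulrAC ler_wpM2r //.
by rewrite divr_ge0 ?expR_ge0 // subr_ge0 ltW.
Qed.

Lemma near_one_qpoch_inf x (c : R) p : cmod p < 1 -> 0 <= c ->
  (forall N n, cmod (x N n) <= c * r ^+ N) ->
  near_one r (fun N n => qpoch_inf (x N n) p).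
Proof.
move=> p1 c0 h; have b0 := bound p1 c0; have /andP[r0 r1] := r01.
exists (c * (expR (c / (1 - cmod p)) / (1 - cmod p))), 0%N; split=> // N n _.
have xc : cmod (x N n) <= c.
  by rewrite (le_trans (h _ _)) // ler_piMr // exprn_ile1 // ltW.
rewrite (le_trans (qpoch_inf_dist1 p1 xc)) // mulrAC ler_wpM2r //.
by rewrite divr_ge0 ?expR_ge0 // subr_ge0 ltW.
Qed.

Lemma near_one_series f (w : nat -> R[i]) (A rho : R) (W : R[i])
    (S : nat -> R[i]) :
  near_one r f -> 0 <= rho < 1 -> (forall n, cmod (w n) <= A * rho ^+ n) ->
  tends (series w) W ->
  (forall N, tends (series (fun n => w n * f N n)) (S N)) ->
  exists B : R, exists N0 : nat, 0 <= B /\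
    forall N, (N0 <= N)%N -> cmod (S N - W) <= B * r ^+ N.
Proof.
have /andP[r0 r1] := r01.
move=> [B [N0 [B0 hf]]] /andP[rho0 rho1] wA wW wS.
have A0 : 0 <= A by have := wA 0%N; rewrite expr0 mulr1; apply: le_trans; exact: cmod_ge0.
exists (B * A / (1 - rho)), N0; split.
  by rewrite divr_ge0 ?mulr_ge0 // subr_ge0 ltW.
move=> N N0N; rewrite mulrAC; apply: series_close (wS N) wW.
- by rewrite !mulr_ge0 // exprn_ge0 // ltW.
- by rewrite rho0.
move=> n; rewrite -{2}[w n]mulr1 -mulrBr cmodM.
rewrite (_ : B * A * _ * _ = A * rho ^+ n * (B * r ^+ N)); last by ring.
by rewrite ler_pM ?cmod_ge0 ?hf.
Qed.

End NearOne.

(** * The summands of the two sides *)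

Section Terms.
Variables (R : realType) (q l : R[i]).

(** The weights are the values of the summands at b = c = 0; they are the terms
    of two q-binomial series. *)
Definition phi_weight (m : nat) : R[i] :=
  qpoch (q * l ^+ 2) q m / qpoch q q m * (- q) ^+ m.

Definition phi_factor (b : R[i]) (m : nat) : R[i] :=
  qpoch b q m * qpoch_inf (b * q ^+ m.+1) (q ^+ 2) *
  qpoch_inf (l ^+ 2 * b * q ^+ m.+2) (q ^+ 2).

Definition phi_summand (b c : R[i]) (m : nat) : R[i] :=
  phi_weight m * phi_factor b m * phi_factor c m.

Definition W_weight (n : nat) : R[i] :=
  qpoch (q * l) q n / qpoch q q n * (- (q * l)) ^+ n.

Definition W_factor (b : R[i]) (n : nat) : R[i] :=
  qpoch b q n * qpoch_inf (l * b * q ^+ n.+1) q.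

(** The part of the very-well-poised summand that depends on b and c only
    through t = bc.  With its infinite products included, shifts of t and of n
    multiply it by rational functions, and it is 1 at t = 0. *)
Definition W_core (t : R[i]) (n : nat) : R[i] :=
  qpoch_inf (t * q) (q ^+ 2) * qpoch t (q ^+ 2) n / qpoch t q n *
  qpoch_inf (l ^+ 2 * t * q ^+ 2 * (q ^+ 2) ^+ n) (q ^+ 2) *
  (1 - l * t * (q ^+ 2) ^+ n) / qpoch_inf (l * t * q ^+ n) q.

Definition W_summand (b c : R[i]) (n : nat) : R[i] :=
  W_weight n * W_core (b * c) n * (W_factor b n * W_factor c n).

End Terms.

(** * Creative telescoping *)

Section Telescoping.
Variables (R : realType) (q l : R[i]).
Hypothesis q1 : cmod q < 1.
Hypothesis q0 : q != 0.
Implicit Types (b c t : R[i]) (n m : nat).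

Let q21 : cmod (q ^+ 2) < 1.
Proof. by rewrite cmodX exprn_ilt1 ?cmod_ge0. Qed.

Lemma qX_neq1 n : 1 - q ^+ n.+1 != 0.
Proof.
rewrite subr_eq0 eq_sym -subr_eq0; apply/negP => /eqP/subr0_eq h.
have := congr1 (@cmod R) h; rewrite cmodX cmod1 => /eqP.
by rewrite lt_eqF // exprn_ilt1 ?cmod_ge0.
Qed.

Lemma qpoch_qq_neq0 n : qpoch q q n != 0.
Proof. by apply: qpoch_neq0 => j; rewrite -exprS qX_neq1. Qed.

Lemma phi_weightS m : (1 - q ^+ m.+1) * phi_weight q l m.+1 =
  - q * (1 - l ^+ 2 * q ^+ m.+1) * phi_weight q l m.
Proof.
have h := qX_neq1 m; have h' := qpoch_qq_neq0 m.
rewrite /phi_weight !qpochS !exprS; rewrite exprS in h.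
field; by rewrite h h'.
Qed.

(** Shifting b by q is the same as shifting the index, up to the factor 1 - b.
    This is why the shift (b,c) -> (bq,cq) can be handled by summation by parts. *)
Lemma phi_factorS b m :
  phi_factor q l b m.+1 = (1 - b) * phi_factor q l (b * q) m.
Proof. by rewrite /phi_factor qpochSl !exprS !mulrA. Qed.

Lemma phi_factorSS b m : (1 - l ^+ 2 * b * q ^+ m.+2) * phi_factor q l b m.+2 =
  (1 - b * q ^+ m) * phi_factor q l b m.
Proof.
rewrite /phi_factor !qpochS.
rewrite (qpoch_infS (b * q ^+ m.+1) q21) (qpoch_infS (l ^+ 2 * b * q ^+ m.+2) q21).
have -> : b * q ^+ m.+1 * q ^+ 2 = b * q ^+ m.+3 by rewrite -mulrA -exprD addn2.
have -> : l ^+ 2 * b * q ^+ m.+2 * q ^+ 2 = l ^+ 2 * b * q ^+ m.+4.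
  by rewrite -mulrA -exprD addn2.
by ring.
Qed.

(** With P_m = phi_factor b m * phi_factor c m, and divided by (1 - b)(1 - c),
    this is (q^(-m) - 1) w_m [(1 - bc q^m) P_m - (1 - l^2 bc q^(m+2)) P_(m+1)].
    Writing P_m through the factors at bq and cq avoids the division, which is
    impossible at b = 1.  The weight w_m has size |q|^m, so the first two factors
    are only bounded; the bracket tends to 0. *)
Definition phi_antidiff b c m : R[i] :=
  if m is m'.+1 then
    ((q ^+ m)^-1 - 1) * phi_weight q l m *
    ((1 - b * c * q ^+ m) * phi_factor q l (b * q) m' * phi_factor q l (c * q) m'
     - (1 - l ^+ 2 * b * c * q ^+ m.+2) *
       phi_factor q l (b * q) m * phi_factor q l (c * q) m)
  else 0.

(** In the notation above, P_(m+2) is a rational multiple of P_m; once it is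
    eliminated, the coefficients of P_m and of P_(m+1) agree separately. *)
Lemma phi_telescope b c m :
  phi_summand q l b c m
  - (1 - l ^+ 2 * q) * (1 - b * c * q) * phi_summand q l (b * q) (c * q) m
  - l ^+ 2 * q * ((1 - b * q) * (1 - c * q)) ^+ 2 *
    phi_summand q l (b * q ^+ 2) (c * q ^+ 2) m
  = phi_antidiff b c m.+1 - phi_antidiff b c m.
Proof.
have h2 d : (1 - d * q) * phi_factor q l (d * q ^+ 2) m = phi_factor q l (d * q) m.+1.
  by rewrite phi_factorS expr2 mulrA.
rewrite /phi_summand.
have -> : l ^+ 2 * q * ((1 - b * q) * (1 - c * q)) ^+ 2 *
    (phi_weight q l m * phi_factor q l (b * q ^+ 2) m * phi_factor q l (c * q ^+ 2) m)
  = l ^+ 2 * q * (1 - b * q) * (1 - c * q) * phi_weight q l m *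
    (phi_factor q l (b * q) m.+1 * phi_factor q l (c * q) m.+1).
  by rewrite -!h2; ring.
have qm0 : q ^+ m != 0 by rewrite expf_neq0.
have wS := phi_weightS m.
have wS' : ((q ^+ m.+1)^-1 - 1) * phi_weight q l m.+1 =
    - (1 - l ^+ 2 * q ^+ m.+1) * phi_weight q l m / q ^+ m.
  rewrite (_ : ((q ^+ m.+1)^-1 - 1) * phi_weight q l m.+1 =
    (1 - q ^+ m.+1) * phi_weight q l m.+1 / q ^+ m.+1).
    rewrite wS (exprS q m); field; by rewrite q0 qm0.
  by field; rewrite expf_neq0.
case: m => [|m] in h2 qm0 wS wS' *.
  rewrite /phi_antidiff wS' subr0.
  have h d : phi_factor q l d 0 = (1 - l ^+ 2 * d * q ^+ 2) * phi_factor q l (d * q) 1.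
    rewrite /phi_factor qpochS !qpoch0 !mul1r !expr1 !expr0 mulr1.
    rewrite (qpoch_infS (d * q) q21) (qpoch_infS (l ^+ 2 * d * q ^+ 2) q21).
    have -> : d * q * q ^+ 2 = d * q ^+ 3 by ring.
    have -> : l ^+ 2 * d * q ^+ 2 * q ^+ 2 = l ^+ 2 * (d * q) * q ^+ 3 by ring.
    by ring.
  rewrite (h b) (h c) expr0 invr1 /phi_weight !qpoch0 expr0 invr1.
  by ring.
rewrite /phi_antidiff wS' (phi_factorS b m) (phi_factorS c m).
have e d : (1 - l ^+ 2 * d * q ^+ m.+3) * phi_factor q l (d * q) m.+2 =
    (1 - d * q ^+ m.+1) * phi_factor q l (d * q) m.
  have := phi_factorSS (d * q) m.
  have -> : l ^+ 2 * (d * q) * q ^+ m.+2 = l ^+ 2 * d * q ^+ m.+3.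
    by rewrite (exprS q m.+2); ring.
  by have -> : d * q * q ^+ m = d * q ^+ m.+1 by rewrite exprS mulrA.
have eb := e b; have ec := e c.
set F0 := phi_factor q l (b * q) m in eb *; set F2 := phi_factor q l (b * q) m.+2 in eb *.
set G0 := phi_factor q l (c * q) m in ec *; set G2 := phi_factor q l (c * q) m.+2 in ec *.
set w := phi_weight _ _ _; set F1 := phi_factor _ _ _ _; set G1 := phi_factor _ _ _ _.
have key : (1 - l ^+ 2 * b * q ^+ m.+3) * F2 * ((1 - l ^+ 2 * c * q ^+ m.+3) * G2) =
    (1 - b * q ^+ m.+1) * F0 * ((1 - c * q ^+ m.+1) * G0) by rewrite eb ec.
move: key qm0; rewrite !(exprS q m.+1, exprS q m.+2, exprS q m.+3).
set x := q ^+ m.+1 => key x0.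
apply/eqP; rewrite -subr_eq0; apply/eqP.
transitivity ((((1 - l ^+ 2 * b * (q * (q * x))) * F2 * ((1 - l ^+ 2 * c * (q * (q * x))) * G2)) -
    (1 - b * x) * F0 * ((1 - c * x) * G0)) * (- w / x)); last by rewrite key subrr mul0r.
by field.
Qed.

Lemma W_weightS n : (1 - q ^+ n.+1) * W_weight q l n.+1 =
  - (q * l) * (1 - l * q ^+ n.+1) * W_weight q l n.
Proof.
have h := qX_neq1 n; have h' := qpoch_qq_neq0 n.
rewrite /W_weight !qpochS !exprS; rewrite exprS in h.
field; by rewrite h h'.
Qed.

Lemma W_factorS b n :
  W_factor q l b n.+1 = (1 - b) * W_factor q l (b * q) n.
Proof. by rewrite /W_factor qpochSl !exprS !mulrA. Qed.

Lemma W_factorSr b n : (1 - l * b * q ^+ n.+1) * W_factor q l b n.+1 =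
  (1 - b * q ^+ n) * W_factor q l b n.
Proof.
rewrite /W_factor qpochS (qpoch_infS (l * b * q ^+ n.+1) q1).
by rewrite -[l * b * _ * q]mulrA -exprSr; ring.
Qed.

(** The factors at t = bc that are inverted in the summands or in the relations
    between them; the condition is stable under the shift t -> t q^2. *)
Definition W_regular t : Prop :=
  [/\ forall j, 1 - t * q ^+ j != 0, forall j, 1 - l * t * q ^+ j != 0 &
      forall j, 1 - l ^+ 2 * t * q ^+ 2 * (q ^+ 2) ^+ j != 0].

Lemma W_regular_shift t : W_regular t -> W_regular (t * q ^+ 2).
Proof.
move=> [h1 h2 h3]; split=> j.
- by have := h1 j.+2; rewrite !exprS expr0 mulr1 !mulrA.
- by have := h2 j.+2; rewrite !exprS expr0 mulr1 !mulrA.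
- by have := h3 j.+1; rewrite !exprS expr0 mulr1 !mulrA.
Qed.

Lemma W_coreS t n : W_regular t -> W_core q l t n.+1 = W_core q l t n *
  ((1 - t * (q ^+ n) ^+ 2) * (1 - l * t * q ^+ 2 * (q ^+ n) ^+ 2) *
   (1 - l * t * q ^+ n)) /
  ((1 - t * q ^+ n) * (1 - l ^+ 2 * t * q ^+ 2 * (q ^+ n) ^+ 2) *
   (1 - l * t * (q ^+ n) ^+ 2)).
Proof.
move=> [h1 h2 h3]; have e2 : (q ^+ 2) ^+ n = (q ^+ n) ^+ 2 by rewrite -!exprM mulnC.
rewrite /W_core !qpochS (exprS (q ^+ 2) n) e2.
rewrite (qpoch_infS (l ^+ 2 * t * q ^+ 2 * (q ^+ n) ^+ 2) q21).
rewrite (qpoch_infS (l * t * q ^+ n) q1).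
have -> : l ^+ 2 * t * q ^+ 2 * (q ^+ n) ^+ 2 * q ^+ 2 =
  l ^+ 2 * t * q ^+ 2 * (q ^+ 2 * (q ^+ n) ^+ 2) by ring.
have -> : l * t * q ^+ n.+1 = l * t * q ^+ n * q by rewrite exprS; ring.
have hq : qpoch_inf (l * t * q ^+ n * q) q != 0.
  apply: qpoch_inf_neq0 => // j.
  by have := h2 (n + j.+1)%N; rewrite exprD exprS !mulrA.
have hp := qpoch_neq0 n h1.
have := h1 n; have := h2 n; have := h2 (n + n)%N; have := h3 n.
rewrite e2 exprD -expr2; set x := q ^+ n => a1 a2 a3 a4.
set i1 := qpoch_inf (t * q) _; set i2 := qpoch_inf _ (q ^+ 2).
move: hp hq; set i3 := qpoch_inf _ _; set i4 := qpoch t q n => hp hq.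
set i5 := qpoch t _ n.
by field; rewrite a1 a2 a3 a4 hq hp.
Qed.

Lemma W_core_shift t n : W_regular t -> W_core q l (t * q ^+ 2) n =
  W_core q l t n.+1 * (1 - l * t * q ^+ n.+1) / (1 - t * q ^+ n.+1).
Proof.
move=> [h1 h2 h3].
have p1 : qpoch t (q ^+ 2) n.+1 = (1 - t) * qpoch (t * q ^+ 2) (q ^+ 2) n.
  by rewrite qpochSl.
have p2 : qpoch t q n.+1 * (1 - t * q ^+ n.+1) =
    (1 - t) * (1 - t * q) * qpoch (t * q ^+ 2) q n.
  by rewrite -qpochS !qpochSl expr2 !mulrA.
have p3 : qpoch_inf (t * q) (q ^+ 2) = (1 - t * q) * qpoch_inf (t * q ^+ 2 * q) (q ^+ 2).
  rewrite (qpoch_infS (t * q) q21).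
  by have -> : t * q * q ^+ 2 = t * q ^+ 2 * q by ring.
have p4 : qpoch_inf (l * t * q ^+ n.+1) q =
    (1 - l * t * q ^+ n.+1) * qpoch_inf (l * (t * q ^+ 2) * q ^+ n) q.
  have <- : l * t * q ^+ n.+1 * q = l * (t * q ^+ 2) * q ^+ n.
    by rewrite (exprS _ n); ring.
  exact: qpoch_infS.
have hq : qpoch_inf (l * (t * q ^+ 2) * q ^+ n) q != 0.
  apply: qpoch_inf_neq0 => // j.
  have := h2 (n + j.+2)%N; rewrite exprD 2!exprS => h.
  by have -> : l * (t * q ^+ 2) * q ^+ n * q ^+ j =
    l * t * (q ^+ n * (q * (q * q ^+ j))) by ring.
have hp : qpoch (t * q ^+ 2) q n != 0.
  by apply: qpoch_neq0 => j; have := h1 j.+2; rewrite !exprS expr0 mulr1 !mulrA.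
have hp1 := qpoch_neq0 n.+1 h1.
have hl := h2 n.+1; have ht := h1 n.+1.
rewrite /W_core p1 p3 p4.
have -> : l ^+ 2 * t * q ^+ 2 * (q ^+ 2) ^+ n.+1 =
  l ^+ 2 * (t * q ^+ 2) * q ^+ 2 * (q ^+ 2) ^+ n by rewrite (exprS (q ^+ 2) n); ring.
have -> : l * t * (q ^+ 2) ^+ n.+1 = l * (t * q ^+ 2) * (q ^+ 2) ^+ n.
  by rewrite (exprS _ n); ring.
set i1 := qpoch_inf _ _; set i2 := qpoch_inf _ _; set e := 1 - l * (_ * _) * _.
set p := qpoch _ (_ ^+ 2) n.
rewrite -[X in _ = X](_ : (1 - t) * (1 - t * q) * i1 * p * i2 * e /
  (qpoch t q n.+1 * (1 - t * q ^+ n.+1)) / qpoch_inf (l * (t * q ^+ 2) * q ^+ n) q = _);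
  last first.
  by field; rewrite hp1 hq hl ht.
rewrite p2; have t0 := h1 0%N; have t1 := h1 1%N; rewrite expr0 mulr1 in t0.
rewrite expr1 in t1.
by field; rewrite hp hq t0 t1.
Qed.

Definition W_weight_pred n : R[i] :=
  if n is n'.+1 then W_weight q l n' else 0.

(** Each shift of (b,c) lowers by one the index at which a given factor pair
    occurs: where the shifted sum contributes its term of index n, the doubly
    shifted sum contributes its term of index n - 1. *)
Definition W_prev t n : R[i] :=
  if n is n'.+1 then W_weight q l n' * W_core q l (t * q ^+ 4) n' else 0.

(** The telescoping certificate.  Collecting the shifted summands that are
    rational multiples of
    Q_n = W_factor b n * W_factor c n / ((1 - b)(1 - c)) leads to an equation
      y_n Q_n = Z_(n+1) - Z_n,   Z_n = z_n (1 - l b q^n)(1 - l c q^n) Q_n,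
    where y_n is affine in b + c.  If z_n depends on b and c through t only, the
    coefficients of 1 and of b + c give two equations that determine z_n and
    z_(n+1); they turn out to be consistent, and [W_zeta n] is z_(n+1). *)
Definition W_zeta t n : R[i] :=
  (W_weight q l n + q * l ^+ 2 * W_weight_pred n) *
  W_core q l (t * q ^+ 2) n * (1 - t * q) *
  (1 - l ^+ 2 * t * q ^+ 2 * (q ^+ n) ^+ 2) /
  ((1 - l * t * q * q ^+ n) * (1 - l * t * q ^+ 2 * (q ^+ n) ^+ 2)).

(** The coefficients of b + c and of 1 in the certificate equation. *)
Lemma W_zeta_rec t n : W_regular t ->
  (q * q ^+ n * W_zeta t n.+1 = l * q * q ^+ n * W_zeta t n +
    W_weight q l n.+1 * W_core q l t n.+1 - l ^+ 2 * q ^+ 2 * W_prev t n) /\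
  ((1 + t * q ^+ 2 * (q ^+ n) ^+ 2) * W_zeta t n.+1 =
    (1 + l ^+ 2 * t * q ^+ 2 * (q ^+ n) ^+ 2) * W_zeta t n +
    (1 + t) * W_weight q l n.+1 * W_core q l t n.+1
    - (1 - l ^+ 2 * q) * (1 - t * q) * W_weight q l n * W_core q l (t * q ^+ 2) n
    - l ^+ 2 * q * (1 + t * q ^+ 2) * W_prev t n).
Proof.
move=> treg; have r2 := W_regular_shift treg; have [h1 h2 h3] := treg.
have e2 m : (q ^+ 2) ^+ m = (q ^+ m) ^+ 2 by rewrite -!exprM mulnC.
have h1' j : 1 - t * q ^+ j * q ^+ n != 0 by have := h1 (j + n)%N; rewrite exprD mulrA.
have h2' j : 1 - l * t * q ^+ j * q ^+ n != 0.
  by have := h2 (j + n)%N; rewrite exprD mulrA.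
have h2'' j : 1 - l * t * q ^+ j * (q ^+ n) ^+ 2 != 0.
  by have := h2 (j + (n + n))%N; rewrite !exprD -expr2 mulrA.
have h3' j : 1 - l ^+ 2 * t * q ^+ 2 * (q ^+ j) ^+ 2 * (q ^+ n) ^+ 2 != 0.
  by have := h3 (j + n)%N; rewrite exprD !e2 mulrA.
have c1 : W_core q l t n.+1 = W_core q l (t * q ^+ 2) n *
    (1 - t * q * q ^+ n) / (1 - l * t * q * q ^+ n).
  rewrite (W_core_shift n treg) exprS.
  have := h1' 1%N; have := h2' 1%N; rewrite expr1 => a1 a2.
  by field; rewrite -!mulrA in a1 a2 *; rewrite a1 a2.
have c2 := W_coreS n r2.
have wS := W_weightS n; have qn := qX_neq1 n.
have wS' : W_weight q l n.+1 =
    - (q * l) * (1 - l * q ^+ n.+1) * W_weight q l n / (1 - q ^+ n.+1).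
  by rewrite -wS mulrAC mulfV // mul1r.
have a2 := h1' 2%N; have b1 := h2' 1%N; have d2 := h2'' 2%N.
have d4 := h2'' 4%N; have g1 := h3' 1%N.
have e4 : l * t * q ^+ 4 = l * t * q ^+ 2 * q ^+ 2 by ring.
have eg : l ^+ 2 * t * q ^+ 2 * (q ^+ 1) ^+ 2 = l ^+ 2 * (t * q ^+ 2) * q ^+ 2.
  by ring.
rewrite e4 in d4; rewrite eg in g1.
have d5 : 1 - l * t * q ^+ 2 * (q * q ^+ n) ^+ 2 != 0 by rewrite exprMn mulrA.
have b3 : 1 - l * t * q * (q * q ^+ n) != 0.
  by rewrite mulrA -[l * t * q * q]mulrA; exact: (h2' 2%N).
have wp : W_prev t n = W_weight_pred n *
    (W_core q l (t * q ^+ 2) n * (1 - l * t * q ^+ 2 * q ^+ n) /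
      (1 - t * q ^+ 2 * q ^+ n)).
  rewrite /W_prev /W_weight_pred; case: (n) => [|n']; first by rewrite mul0r.
  have -> : t * q ^+ 4 = t * q ^+ 2 * q ^+ 2 by ring.
  by rewrite (W_core_shift n' r2) !mulrA.
have wpS : W_weight_pred n.+1 = W_weight q l n by [].
rewrite wp /W_zeta wpS c1 c2 wS'.
(* Both weights are multiples of a common D, except at index 0, where
   1 = - q l (1 - l) D need not have a solution. *)
have [[w0 wp0 x1]|[D [wD wpD]]] :
    [/\ W_weight q l n = 1, W_weight_pred n = 0 & q ^+ n = 1] \/
    exists D, W_weight q l n = - (q * l) * (1 - l * q ^+ n) * D /\
      W_weight_pred n = (1 - q ^+ n) * D.
- case: (n) => [|n']; first by left; rewrite /W_weight !qpoch0 expr0; split=> //; field.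
  right; exists (W_weight q l n' / (1 - q ^+ n'.+1)).
  have qn' := qX_neq1 n'; split; last by rewrite /=; field.
  apply: (mulfI qn'); rewrite W_weightS; field; by [].
- rewrite w0 wp0 !(exprS q n) x1 in qn a2 b1 d2 d4 g1 *.
  rewrite !(expr0, expr1, expr1n, mulr1) in qn a2 b1 d2 d4 g1 *.
  set U := W_core _ _ _ _.
  by split; field; rewrite ?qn ?a2 ?b1 ?d2 ?d4 ?g1.
rewrite wD wpD !(exprS q n) in qn a2 b1 d2 d4 g1 *.
rewrite !(expr0, expr1, expr1n, mulr1) in qn a2 b1 d2 d4 g1 *.
set U := W_core _ _ _ _; set x := q ^+ n in d5 b3 qn a2 b1 d2 d4 g1 *.
by split; field; rewrite a2 b1 qn d2 d5 b3 g1.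
Qed.

(** The certificate together with the boundary terms that arise when the three
    shifted sums are aligned at a common index. *)
Definition W_antidiff b c N : R[i] :=
  if N is n.+1 then
    (W_zeta (b * c) n * (1 - l * b * q ^+ N) * (1 - l * c * q ^+ N)
     - (1 - l ^+ 2 * q) * (1 - b * c * q) *
       (W_weight q l n * W_core q l (b * c * q ^+ 2) n)
     - l ^+ 2 * q * (1 - b * q) * (1 - c * q) * W_prev (b * c) n) *
    (W_factor q l (b * q) n * W_factor q l (c * q) n)
    - l ^+ 2 * q * (1 - b * q) * (1 - c * q) *
      (W_weight q l n * W_core q l (b * c * q ^+ 4) n) *
      (W_factor q l (b * q) N * W_factor q l (c * q) N)
  else 0.

Lemma W_telescope b c n : W_regular (b * c) ->
  W_summand q l b c n
  - (1 - l ^+ 2 * q) * (1 - b * c * q) * W_summand q l (b * q) (c * q) n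
  - l ^+ 2 * q * ((1 - b * q) * (1 - c * q)) ^+ 2 *
    W_summand q l (b * q ^+ 2) (c * q ^+ 2) n
  = W_antidiff b c n.+1 - W_antidiff b c n.
Proof.
move=> reg.
have h2 d : (1 - d * q) * W_factor q l (d * q ^+ 2) n = W_factor q l (d * q) n.+1.
  by rewrite W_factorS expr2 mulrA.
rewrite /W_summand.
have -> : b * q * (c * q) = b * c * q ^+ 2 by ring.
have -> : b * q ^+ 2 * (c * q ^+ 2) = b * c * q ^+ 4 by ring.
have -> : l ^+ 2 * q * ((1 - b * q) * (1 - c * q)) ^+ 2 *
    (W_weight q l n * W_core q l (b * c * q ^+ 4) n *
     (W_factor q l (b * q ^+ 2) n * W_factor q l (c * q ^+ 2) n))
  = l ^+ 2 * q * (1 - b * q) * (1 - c * q) *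
    (W_weight q l n * W_core q l (b * c * q ^+ 4) n) *
    (W_factor q l (b * q) n.+1 * W_factor q l (c * q) n.+1).
  by rewrite -!h2; ring.
case: n => [|n] in h2 *.
  have f0 d : W_factor q l d 0 = (1 - l * d * q) * W_factor q l (d * q) 0.
    rewrite /W_factor !qpoch0 !mul1r !expr1 (qpoch_infS (l * d * q) q1).
    by rewrite [l * (d * q)]mulrA.
  have z0 : W_zeta (b * c) 0 = W_weight q l 0 * W_core q l (b * c) 0.
    have [h1 h2' h3] := reg.
    have := h1 0%N; have := h1 1%N; have := h2' 0%N; have := h2' 1%N.
    have := h2' 2%N; have := h3 0%N; rewrite !expr0 !expr1 !mulr1 => a1 a2 a3 a4 a5 a6.
    rewrite /W_zeta (W_core_shift 0 reg) (W_coreS 0 reg) expr0 expr1n expr1 !mulr1.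
    by rewrite mulr0 addr0; field; rewrite a1 a2 a3 a4 a5 a6.
  rewrite /W_antidiff z0 (f0 b) (f0 c) /W_prev !expr1.
  by ring.
have [e1 e2] := W_zeta_rec n reg.
have e b' : (1 - l * b' * q ^+ n.+2) * W_factor q l (b' * q) n.+1 =
    (1 - b' * q ^+ n.+1) * W_factor q l (b' * q) n.
  have := W_factorSr (b' * q) n.
  have -> : l * (b' * q) * q ^+ n.+1 = l * b' * q ^+ n.+2 by rewrite (exprS q n.+1); ring.
  by have -> : b' * q * q ^+ n = b' * q ^+ n.+1 by rewrite (exprS q n) mulrA.
have key : (1 - l * b * q ^+ n.+2) * W_factor q l (b * q) n.+1 *
    ((1 - l * c * q ^+ n.+2) * W_factor q l (c * q) n.+1) =
    (1 - b * q ^+ n.+1) * W_factor q l (b * q) n *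
    ((1 - c * q ^+ n.+1) * W_factor q l (c * q) n) by rewrite !e.
rewrite /W_antidiff (W_factorS b n) (W_factorS c n).
have -> : W_prev (b * c) n.+1 = W_weight q l n * W_core q l (b * c * q ^+ 4) n by [].
move: e1 e2 key.
set z1 := W_zeta _ n.+1; set z0 := W_zeta _ n; set p := W_prev _ n.
set F0 := W_factor _ _ (b * q) n; set G0 := W_factor _ _ (c * q) n.
set F1 := W_factor _ _ (b * q) n.+1; set G1 := W_factor _ _ (c * q) n.+1.
set F2 := W_factor _ _ (b * q) n.+2; set G2 := W_factor _ _ (c * q) n.+2.
set w0 := W_weight _ _ n; set w1 := W_weight _ _ n.+1.
set A := W_core _ _ (b * c) _; set B0 := W_core _ _ (b * c * q ^+ 2) n.
set B1 := W_core _ _ (b * c * q ^+ 2) n.+1.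
set D0 := W_core _ _ (b * c * q ^+ 4) n; set D1 := W_core _ _ (b * c * q ^+ 4) n.+1.
rewrite (exprS q n.+1) (exprS q n); set x := q ^+ n => e1 e2 key.
apply/eqP; rewrite -subr_eq0; apply/eqP.
(* [e1] times b + c, minus [e2], minus z1 times [key]. *)
rewrite -[LHS](_ : (q * x * z1 - (l * q * x * z0 + w1 * A - l ^+ 2 * q ^+ 2 * p)) *
    (b + c) * (F0 * G0)
  - ((1 + b * c * q ^+ 2 * x ^+ 2) * z1 -
    ((1 + l ^+ 2 * (b * c) * q ^+ 2 * x ^+ 2) * z0 + (1 + b * c) * w1 * A -
     (1 - l ^+ 2 * q) * (1 - b * c * q) * w0 * B0 -
     l ^+ 2 * q * (1 + b * c * q ^+ 2) * p)) * (F0 * G0)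
  - z1 * ((1 - l * b * (q * (q * x))) * F1 * ((1 - l * c * (q * (q * x))) * G1) -
    (1 - b * (q * x)) * F0 * ((1 - c * (q * x)) * G0)) = _).
  by rewrite e1 e2 key !subrr !mul0r mulr0 subrr subrr.
by ring.
Qed.

End Telescoping.

(** * Convergence and the q-difference equation *)

Section Asymptotics.
Variables (R : realType) (q l : R[i]).
Hypothesis q1 : cmod q < 1.
Hypothesis q0 : q != 0.
Implicit Types (b c t z : R[i]) (n m N : nat).

Let q21 : cmod (q ^+ 2) < 1.
Proof. by rewrite cmodX exprn_ilt1 ?cmod_ge0. Qed.

Let q01 : 0 < cmod q < 1.
Proof. by rewrite cmod_gt0 q0 q1. Qed.

Lemma qpoch_inf_tends1 (x : nat -> R[i]) p : cmod p < 1 -> tends x 0 ->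
  tends (fun n => qpoch_inf (x n) p) 1.
Proof.
move=> p1 x0; have [c xc] := tends_bounded x0.
set K := expR (c / (1 - cmod p)) / (1 - cmod p).
have h : (fun n => cmod (x n - 0) * K) @ \oo --> (0 : R).
  by rewrite -[X in _ --> X](mul0r K); exact: cvgM x0 (cvg_cst _).
by apply: tends_squeeze h => n; rewrite subr0; exact: qpoch_inf_dist1.
Qed.

Lemma tends_mulX z p k : cmod p < 1 -> tends (fun n => z * p ^+ (n + k)) 0.
Proof.
by move=> p1; rewrite -[X in tends _ X](mulr0 z); apply: tendsZ;
  exact: (tends_shift k (tends_expr p1)).
Qed.

Lemma tends_mulX0 z p : cmod p < 1 -> tends (fun n => z * p ^+ n) 0.
Proof.
by move=> p1; rewrite -[X in tends _ X](mulr0 z); exact: tendsZ (tends_expr p1).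
Qed.

Lemma qq_inf_neq0 : qpoch_inf q q != 0.
Proof. by apply: qpoch_inf_neq0 => // j; rewrite -exprS qX_neq1. Qed.

Lemma qbinomial_coef_tends z :
  tends (fun n => qpoch z q n / qpoch q q n) (qpoch_inf z q / qpoch_inf q q).
Proof.
apply: tendsM (qpoch_tends z q1) _.
exact: tendsV qq_inf_neq0 (qpoch_tends q q1).
Qed.

Lemma phi_factor_tends b : tends (phi_factor q l b) (qpoch_inf b q).
Proof.
rewrite -[X in tends _ X](mulr1 (qpoch_inf b q)).
rewrite -[X in tends _ X](mulr1 (qpoch_inf b q * 1)).
apply: tendsM; [apply: tendsM (qpoch_tends b q1) _|].
  apply: qpoch_inf_tends1 => //.
  by apply: eq_tends (tends_mulX b 1 q1) => n; rewrite addn1.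
apply: qpoch_inf_tends1 => //.
by apply: eq_tends (tends_mulX (l ^+ 2 * b) 2 q1) => n; rewrite addn2.
Qed.

Lemma series_tends_geom (u v : nat -> R[i]) z a : cmod z < 1 ->
  tends u a -> (forall n, v n = u n * z ^+ n) -> exists S, tends (series v) S.
Proof.
move=> z1 /tends_bounded[B uB] vE.
apply: (@tends_dominated _ _ B (cmod z)); first by rewrite cmod_ge0.
by move=> n; rewrite vE cmodM cmodX ler_wpM2r ?exprn_ge0 ?cmod_ge0.
Qed.

Lemma phi_series_cvg b c : exists S, tends (series (phi_summand q l b c)) S.
Proof.
have z1 : cmod (- q) < 1 by rewrite cmodN.
apply: (series_tends_geom z1 (tendsM (tendsM (qbinomial_coef_tends (q * l ^+ 2))
  (phi_factor_tends b)) (phi_factor_tends c))) => n.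
by rewrite /phi_summand /phi_weight; ring.
Qed.

(** Bounded factor times a bracket whose two terms have the same limit. *)
Lemma phi_antidiff_tends b c : tends (phi_antidiff q l b c) 0.
Proof.
apply: tends_shiftS.
have [B hB] : exists B : R, forall n, cmod (- (1 - q ^+ n.+1) *
    (qpoch (q * l ^+ 2) q n.+1 / qpoch q q n.+1) * (-1) ^+ n) <= B.
  have h := tendsM (tendsB (tends_cst 1) (tends_shift 1 (tends_expr q1)))
    (tends_shift 1 (qbinomial_coef_tends (q * l ^+ 2))).
  have [B hB] := tends_bounded h; exists B => n.
  have := hB n; rewrite /= addn1 => hBn.
  by rewrite cmodM [cmod (_ ^+ n)]cmodX [cmod (-1)]cmodN cmod1 expr1n mulr1 mulNr cmodN.
have fb := phi_factor_tends (b * q); have fc := phi_factor_tends (c * q).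
have h1 := tendsM (tendsM (tendsB (tends_cst 1) (tends_mulX (b * c) 1 q1)) fb) fc.
have h2 := tendsM (tendsM (tendsB (tends_cst 1)
  (tends_mulX (l ^+ 2 * b * c) 3 q1)) (tends_shift 1 fb)) (tends_shift 1 fc).
have h := tendsB h1 h2; rewrite subrr in h.
apply: eq_tends (tendsM0 hB h) => n.
rewrite /phi_antidiff /phi_weight addn1 addn3 -[in RHS](mulN1r q) exprMn.
have qn : q ^+ n.+1 != 0 by rewrite expf_neq0.
set x := q ^+ n.+1 in qn *; set F := phi_factor _ _ _ _; set G := phi_factor _ _ _ _.
set F1 := phi_factor _ _ _ n.+1; set G1 := phi_factor _ _ _ n.+1.
rewrite (exprS (-1) n).
by field; rewrite qpoch_qq_neq0.
Qed.

(** The sequence u2 absorbs its coefficient, so that it may converge for the sole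
    reason that the coefficient is 0. *)
Lemma sum_recurrence (u0 u1 u2 T : nat -> R[i]) (al S1 S2 : R[i]) :
  (forall n, u0 n - al * u1 n - u2 n = T n.+1 - T n) -> T 0%N = 0 ->
  tends T 0 -> tends (series u1) S1 -> tends (series u2) S2 ->
  tends (series u0) (al * S1 + S2).
Proof.
move=> uT T0 Tl s1 s2.
have h := tendsD (tendsD Tl (tendsZ al s1)) s2; rewrite add0r in h.
apply: eq_tends h => n; elim: n => [|n IHn].
  by rewrite T0 /series /= !big_geq // mulr0 !addr0.
rewrite !seriesSr -IHn.
have -> : u0 n = al * u1 n + u2 n + (T n.+1 - T n) by rewrite -uT; ring.
ring.
Qed.

Lemma phi_recurrence b c (S1 S2 : R[i]) :
  tends (series (phi_summand q l (b * q) (c * q))) S1 ->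
  tends (series (phi_summand q l (b * q ^+ 2) (c * q ^+ 2))) S2 ->
  tends (series (phi_summand q l b c))
    ((1 - l ^+ 2 * q) * (1 - b * c * q) * S1 +
     l ^+ 2 * q * ((1 - b * q) * (1 - c * q)) ^+ 2 * S2).
Proof.
move=> s1 s2; apply: (sum_recurrence (T := phi_antidiff q l b c)) s1 _.
- exact: phi_telescope.
- by [].
- exact: phi_antidiff_tends.
apply: eq_tends (tendsZ _ s2) => n.
by rewrite /series /= mulr_sumr.
Qed.

Lemma W_factor_tends b : tends (W_factor q l b) (qpoch_inf b q).
Proof.
rewrite -[X in tends _ X](mulr1 (qpoch_inf b q)).
apply: tendsM (qpoch_tends b q1) _.
apply: qpoch_inf_tends1 => //.
by apply: eq_tends (tends_mulX (l * b) 1 q1) => n; rewrite addn1.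
Qed.

Lemma W_core_tends t : W_regular q l t -> tends (W_core q l t)
  (qpoch_inf (t * q) (q ^+ 2) * qpoch_inf t (q ^+ 2) / qpoch_inf t q).
Proof.
move=> [h1 h2 h3].
rewrite -[X in tends _ X]mulr1 -[X in tends _ X]mulr1 -[X in tends _ X]divr1.
apply: tendsM; last first.
  apply: tendsV; rewrite ?oner_eq0 //.
  exact: qpoch_inf_tends1 (tends_mulX0 (l * t) q1).
apply: tendsM; last first.
  by rewrite -[X in tends _ X]subr0; apply: tendsB (tends_cst 1) _; exact: tends_mulX0.
apply: tendsM; last first.
  by apply: qpoch_inf_tends1 => //; exact: tends_mulX0.
apply: tendsM; last first.
  by apply: tendsV (qpoch_tends t q1); exact: qpoch_inf_neq0.
exact: tendsZ (qpoch_tends t q21).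
Qed.

(** The limit of u is explicit because its non-vanishing is what forces
    |q l| < 1 when the series converges without terminating. *)
Lemma W_summand_tends b c : W_regular q l (b * c) -> exists u : nat -> R[i],
  (forall n, W_summand q l b c n = u n * (- (q * l)) ^+ n) /\
  tends u (qpoch_inf (q * l) q / qpoch_inf q q *
    (qpoch_inf (b * c * q) (q ^+ 2) * qpoch_inf (b * c) (q ^+ 2) /
      qpoch_inf (b * c) q) * (qpoch_inf b q * qpoch_inf c q)).
Proof.
move=> reg; exists (fun n => qpoch (q * l) q n / qpoch q q n *
  W_core q l (b * c) n * (W_factor q l b n * W_factor q l c n)).
split=> [n|]; first by rewrite /W_summand /W_weight; ring.
apply: tendsM (tendsM (qbinomial_coef_tends _) (W_core_tends reg)) _.
exact: tendsM (W_factor_tends b) (W_factor_tends c).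
Qed.

Lemma W_series_cvg b c : cmod (q * l) < 1 -> W_regular q l (b * c) ->
  exists S, tends (series (W_summand q l b c)) S.
Proof.
move=> ql1 /W_summand_tends[u [uE ul]].
by apply: series_tends_geom ul uE; rewrite cmodN.
Qed.

Lemma W_antidiff_tends b c : cmod (q * l) < 1 -> W_regular q l (b * c) ->
  tends (W_antidiff q l b c) 0.
Proof.
move=> ql1 reg; apply: tends_shiftS.
have w0 : tends (W_weight q l) 0.
  have [B hB] := tends_bounded (qbinomial_coef_tends (q * l)).
  by apply: (tendsM0 hB); apply: tends_expr; rewrite cmodN.
have wp0 : tends (W_weight_pred q l) 0 by apply: tends_shiftS.
have r2 := W_regular_shift reg; have r4 := W_regular_shift r2.
rewrite -mulrA -exprD in r4.
have c2 := W_core_tends r2; have c4 := W_core_tends r4.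
have p0 : tends (W_prev q l (b * c)) 0.
  apply: tends_shiftS; have h := tendsM w0 c4; rewrite mul0r in h.
  exact: eq_tends h.
have inv z p : cmod p < 1 -> tends (fun n => (1 - z * p ^+ n)^-1) 1.
  move=> p1; rewrite -[X in tends _ X]invr1.
  apply: tendsV; rewrite ?oner_eq0 // -[X in tends _ X]subr0.
  by apply: tendsB (tends_cst 1) _; exact: tends_mulX0.
have z0 : tends (W_zeta q l (b * c)) 0.
  have h1 := tendsD w0 (tendsZ (q * l ^+ 2) wp0).
  have h2 := tendsM (tendsM h1 c2) (tends_cst (1 - b * c * q)).
  have h3 := tendsM h2 (tendsB (tends_cst 1)
    (tends_mulX0 (l ^+ 2 * (b * c) * q ^+ 2) q21)).
  have h4 := tendsM h3 (tendsM (inv (l * (b * c) * q) _ q1)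
    (inv (l * (b * c) * q ^+ 2) _ q21)).
  rewrite mulr0 addr0 !mul0r in h4.
  apply: eq_tends h4 => n.
  by rewrite /W_zeta -invfM -!exprM mulnC.
have fb := W_factor_tends (b * q); have fc := W_factor_tends (c * q).
have k1 := tendsM (tendsM z0 (tendsB (tends_cst 1) (tends_mulX (l * b) 1 q1)))
  (tendsB (tends_cst 1) (tends_mulX (l * c) 1 q1)).
have k2 := tendsZ ((1 - l ^+ 2 * q) * (1 - b * c * q)) (tendsM w0 c2).
have k3 := tendsZ (l ^+ 2 * q * (1 - b * q) * (1 - c * q)) p0.
have k4 := tendsM (tendsB (tendsB k1 k2) k3) (tendsM fb fc).
have k5 := tendsM (tendsZ (l ^+ 2 * q * (1 - b * q) * (1 - c * q)) (tendsM w0 c4))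
  (tendsM (tends_shift 1 fb) (tends_shift 1 fc)).
have k := tendsB k4 k5.
rewrite !(mul0r, mulr0, subr0) in k.
apply: eq_tends k => n.
by rewrite /W_antidiff !addn1.
Qed.

Lemma W_recurrence b c (S1 S2 : R[i]) : W_regular q l (b * c) ->
  tends (W_antidiff q l b c) 0 ->
  tends (series (W_summand q l (b * q) (c * q))) S1 ->
  tends (series (fun n => (1 - b * q) ^+ 2 *
    W_summand q l (b * q ^+ 2) (c * q ^+ 2) n)) S2 ->
  tends (series (W_summand q l b c))
    ((1 - l ^+ 2 * q) * (1 - b * c * q) * S1 +
     l ^+ 2 * q * (1 - c * q) ^+ 2 * S2).
Proof.
move=> reg T0 s1 s2; apply: (sum_recurrence (T := W_antidiff q l b c)) s1 _ => //.
  by move=> n; exact: W_telescope.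
apply: eq_tends (tendsZ _ s2) => n.
by rewrite /series /= mulr_sumr; apply: eq_bigr => i _; rewrite exprMn; ring.
Qed.

End Asymptotics.

(** * Uniqueness of rapidly decreasing solutions *)

Section Uniqueness.
Variable R : realType.

(** Iterating x_N <= a rho^N + th x_(N+1) sums a geometric series; the a priori
    bound only serves to discard the remainder th^j x_(N+j). *)
Lemma geometric_bootstrap (x : nat -> R) (a B rho sig th : R) M :
  0 <= a -> 0 <= rho < 1 -> 0 <= sig -> 0 <= th -> th * sig < 1 -> th * rho < 1 ->
  (forall N, (M <= N)%N -> x N <= a * rho ^+ N + th * x N.+1) ->
  (forall N, (M <= N)%N -> x N <= B * sig ^+ N) ->
  forall N, (M <= N)%N -> x N <= a / (1 - th * rho) * rho ^+ N.
Proof.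
move=> a0 /andP[rho0 rho1] sig0 th0 ts1 tr1 xS xB N MN.
have tr1' : 0 < 1 - th * rho by rewrite subr_gt0.
have h j : x N <= a / (1 - th * rho) * rho ^+ N +
    B * sig ^+ N * (th * sig) ^+ j.
  have h1 : x N <= a * rho ^+ N * ((1 - (th * rho) ^+ j) / (1 - th * rho)) +
      th ^+ j * x (N + j)%N.
    elim: j => [|j IHj].
      by rewrite !expr0 subrr mul0r mulr0 add0r mul1r addn0.
    apply: (le_trans IHj).
    have := xS (N + j)%N; rewrite (leq_trans MN) ?leq_addr // => /(_ isT) h2.
    have := ler_wpM2l (exprn_ge0 j th0) h2.
    rewrite addnS -(lerD2l (a * rho ^+ N * ((1 - (th * rho) ^+ j) / (1 - th * rho)))).
    move=> /le_trans; apply; rewrite le_eqVlt; apply/orP; left; apply/eqP.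
    by rewrite exprD !exprMn !exprS; field; rewrite gt_eqF.
  apply: (le_trans h1); apply: lerD.
    rewrite [leRHS]mulrAC ler_wpM2l ?mulr_ge0 ?exprn_ge0 //.
    rewrite -[leRHS]mul1r ler_wpM2r ?invr_ge0 ?(ltW tr1') //.
    by rewrite lerBlDr lerDl exprn_ge0 ?mulr_ge0.
  rewrite (_ : B * _ * _ = th ^+ j * (B * sig ^+ (N + j))); last first.
    by rewrite exprMn exprD; ring.
  by rewrite ler_wpM2l ?exprn_ge0 // xB // (leq_trans MN) ?leq_addr.
have lim : (fun j => a / (1 - th * rho) * rho ^+ N +
    B * sig ^+ N * (th * sig) ^+ j) @ \oo --> a / (1 - th * rho) * rho ^+ N.
  rewrite -[X in _ --> X]addr0 -[X in _ --> _ + X](mulr0 (B * sig ^+ N)).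
  apply: cvgD; first exact: cvg_cst.
  apply: cvgM; first exact: cvg_cst.
  by apply: cvg_expr; rewrite ger0_norm // mulr_ge0.
rewrite -(cvg_lim _ lim) //; apply: limr_ge; first by apply/cvg_ex; eexists; exact: lim.
by apply: nearW.
Qed.

(** With e_N = d_N + mu d_(N+1) the recurrence says that e_N - e_(N+1) is
    O(r^N |d|).  A bound B r^N on d thus gives a bound r^(2N) on e, and then on d
    because d is the sum of (-mu)^j e_(N+j) when |mu| r < 1.  For large N the gain
    r^N beats the constants, so the bound can be halved repeatedly and d vanishes
    from some index on; the recurrence carries this down to 0. *)
Lemma recurrence_unique (d al be : nat -> R[i]) (mu : R[i]) (r A B : R) N0 :
  0 < r < 1 -> 0 <= A -> 0 <= B -> cmod mu * r < 1 ->
  (forall N, cmod (al N) <= A * r ^+ N) ->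
  (forall N, cmod (be N) <= A * r ^+ N) ->
  (forall N, d N = (1 - mu) * (1 - al N) * d N.+1 + mu * (1 + be N) * d N.+2) ->
  (forall N, (N0 <= N)%N -> cmod (d N) <= B * r ^+ N) ->
  d 0%N = 0.
Proof.
move=> /andP[r0 r1] A0 B0 mur alA beA dS dB.
have mu0 := cmod_ge0 mu.
have r20 : 0 <= r ^+ 2 by rewrite exprn_ge0 // ltW.
have r21 : r ^+ 2 < 1 by rewrite exprn_ilt1 // ltW.
have mur2 : cmod mu * r ^+ 2 < 1.
  apply: le_lt_trans mur; rewrite ler_wpM2l // expr2 -[leRHS]mulr1.
  by rewrite ler_wpM2l ?ltW.
pose G := A * (1 + 2 * cmod mu).
have G0 : 0 <= G by rewrite mulr_ge0 // addr_ge0 // mulr_ge0.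
pose C1 := G / (1 - 1 * r ^+ 2) / (1 - cmod mu * r ^+ 2).
have C10 : 0 <= C1.
  by rewrite !divr_ge0 // subr_ge0 ?mul1r ltW.
have improve (M : nat) (B' : R) : 0 <= B' ->
    (forall N, (M <= N)%N -> cmod (d N) <= B' * r ^+ N) ->
    forall N, (M <= N)%N -> cmod (d N) <= B' * C1 * (r ^+ 2) ^+ N.
  move=> B'0 dB'.
  pose e N := d N + mu * d N.+1.
  have eB N : (M <= N)%N -> cmod (e N) <= G * B' / (1 - 1 * r ^+ 2) * (r ^+ 2) ^+ N.
    apply: (@geometric_bootstrap (fun N => cmod (e N)) _ (B' * (1 + cmod mu)) _ r 1) => //.
    - by rewrite mulr_ge0.
    - by rewrite r20.
    - exact: ltW.
    - by rewrite mul1r.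
    - by rewrite mul1r.
    - move=> {}N MN; rewrite mul1r.
      have -> : e N = (e N - e N.+1) + e N.+1 by rewrite subrK.
      rewrite (le_trans (cmodD _ _)) // lerD2r.
      have -> : e N - e N.+1 = mu * be N * d N.+2 - (1 - mu) * al N * d N.+1.
        by rewrite /e {1}dS; ring.
      rewrite (le_trans (cmodB _ _)) // !cmodM.
      have h1 := dB' N.+1 (leqW MN); have h2 := dB' N.+2 (leqW (leqW MN)).
      have k1 : cmod (d N.+1) <= B' * r ^+ N.
        by rewrite (le_trans h1) // ler_wpM2l // exprS ler_piMl ?exprn_ge0 ?ltW.
      have k2 : cmod (d N.+2) <= B' * r ^+ N.
        rewrite (le_trans h2) // ler_wpM2l // -addn2 exprD ler_piMr ?(ltW r21) //.
        by rewrite exprn_ge0 // ltW.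
      have k3 : cmod (1 - mu) <= 1 + cmod mu by rewrite (le_trans (cmodB _ _)) // cmod1.
      have -> : G * B' * (r ^+ 2) ^+ N =
        cmod mu * (A * r ^+ N) * (B' * r ^+ N) +
        (1 + cmod mu) * (A * r ^+ N) * (B' * r ^+ N).
        by rewrite /G -exprM mulnC exprM; ring.
      have rN : 0 <= r ^+ N by rewrite exprn_ge0 // ltW.
      by rewrite lerD // !ler_pM ?mulr_ge0 ?cmod_ge0 // !ler_pM ?cmod_ge0.
    - move=> {}N MN; rewrite (le_trans (cmodD _ _)) // cmodM.
      rewrite mulrDr mulr1 mulrDl lerD ?dB' // [B' * _]mulrC -mulrA ler_wpM2l //.
      rewrite (le_trans (dB' N.+1 (leqW MN))) // ler_wpM2l // exprS ler_piMl ?exprn_ge0 //;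
      by rewrite ltW.
  have -> : B' * C1 = G * B' / (1 - 1 * r ^+ 2) / (1 - cmod mu * r ^+ 2).
    by rewrite /C1; ring.
  apply: (@geometric_bootstrap (fun N => cmod (d N)) _ B' _ r (cmod mu)) => //.
  - by apply: divr_ge0; [exact: mulr_ge0|rewrite mul1r subr_ge0 ltW].
  - by rewrite r20.
  - exact: ltW.
  - move=> N MN; have -> : d N = e N - mu * d N.+1 by rewrite /e addrK.
    by rewrite (le_trans (cmodB _ _)) // cmodM lerD2r eB.
have [M [M0 hM]] : exists M, (N0 <= M)%N /\ C1 * r ^+ M <= 1 / 2.
  have /cvgrPdist_lt/(_ (1 / 2))[|N1 _ hN1] : (fun N => C1 * r ^+ N) @ \oo --> (0 : R).
    by rewrite -[X in _ --> X](mulr0 C1); apply: cvgM; [exact: cvg_cst|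
      apply: cvg_expr; rewrite ger0_norm // ltW].
    by lra.
  exists (maxn N0 N1); split; first exact: leq_maxl.
  have := hN1 (maxn N0 N1) (leq_maxr _ _); rewrite /= sub0r normrN => /ltW.
  by apply: le_trans; exact: ler_norm.
have halve j N : (M <= N)%N -> cmod (d N) <= B * (1 / 2) ^+ j * r ^+ N.
  elim: j N => [|j IHj] N MN; first by rewrite expr0 mulr1 dB // (leq_trans M0).
  have Bj : 0 <= B * (1 / 2) ^+ j by rewrite mulr_ge0 // exprn_ge0 //; lra.
  apply: (le_trans (improve M _ Bj IHj N MN)).
  have h2 : 0 <= 1 / 2 :> R by lra.
  have -> : B * (1 / 2) ^+ j * C1 * (r ^+ 2) ^+ N =
    B * (1 / 2) ^+ j * r ^+ N * (C1 * r ^+ N) by rewrite -exprM mulnC exprM; ring.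
  have -> : B * (1 / 2) ^+ j.+1 * r ^+ N = B * (1 / 2) ^+ j * r ^+ N * (1 / 2).
    by rewrite exprSr; ring.
  have rN k : 0 <= r ^+ k by rewrite exprn_ge0 // ltW.
  rewrite ler_wpM2l ?(mulr_ge0 Bj) //; apply: le_trans hM.
  rewrite ler_wpM2l // -(subnK MN) exprD ler_piMl //.
  by rewrite exprn_ile1 // ltW.
have dM N : (M <= N)%N -> d N = 0.
  move=> MN; apply/eqP; rewrite -cmod_eq0 eq_le cmod_ge0 andbT.
  have lim : (fun j => B * (1 / 2) ^+ j * r ^+ N) @ \oo --> (0 : R).
    rewrite -[X in _ --> X](_ : B * 0 * r ^+ N = 0); last by rewrite mulr0 mul0r.
    apply: cvgM; last exact: cvg_cst.
    apply: cvgM; first exact: cvg_cst.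
    by apply: cvg_expr; rewrite ger0_norm; lra.
  rewrite -(cvg_lim _ lim) //; apply: limr_ge; first by apply/cvg_ex; eexists; exact: lim.
  by apply: nearW => j; exact: halve.
have down k : (k <= M)%N -> d (M - k)%N = 0 /\ d (M - k).+1 = 0.
  elim: k => [|k IHk] kM; first by rewrite subn0 !dM // leqnSn.
  have [h1 h2] := IHk (ltnW kM).
  have e : (M - k.+1).+1 = (M - k)%N by rewrite -subSn // subSS.
  by split; rewrite ?e // dS !e h1 h2 !mulr0 addr0.
by have [] := down M (leqnn _); rewrite subnn.
Qed.

End Uniqueness.

(** * The q-binomial theorem *)

Section QBinomial.
Variables (R : realType) (q : R[i]).
Hypothesis q1 : cmod q < 1.
Hypothesis q0 : q != 0.

Let q01 : 0 < cmod q < 1.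
Proof. by rewrite cmod_gt0 q0 q1. Qed.

Let coef (a : R[i]) n := qpoch a q n / qpoch q q n.

(** The sum F satisfies (1 - z) F(z) = (1 - a z) F(zq) by telescoping; iterate it
    and use F(z q^N) -> 1. *)
Lemma qbinomial (a z : R[i]) : cmod z < 1 ->
  tends (series (fun n => qpoch a q n / qpoch q q n * z ^+ n))
    (qpoch_inf (a * z) q / qpoch_inf z q).
Proof.
move=> z1.
have /andP[r0 r1] := q01.
have [A hA] := tends_bounded (qbinomial_coef_tends q1 a).
have A0 : 0 <= A by exact: le_trans (cmod_ge0 _) (hA 0%N).
have zX N : cmod (z * q ^+ N) <= cmod z.
  by rewrite cmodM cmodX ler_piMr ?cmod_ge0 // exprn_ile1 ?ltW.
have zX1 N : cmod (z * q ^+ N) < 1 by exact: le_lt_trans (zX N) z1.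
have sum N : exists S, tends (series (fun n => coef a n * (z * q ^+ N) ^+ n)) S.
  exact: (series_tends_geom (zX1 N) (qbinomial_coef_tends q1 a)).
have [F hF] : exists F : nat -> R[i],
    forall N, tends (series (fun n => coef a n * (z * q ^+ N) ^+ n)) (F N).
  by have [F hF] := @choice _ _ _ sum; exists F.
have FS N : (1 - z * q ^+ N) * F N = (1 - a * z * q ^+ N) * F N.+1.
  set y := z * q ^+ N.
  have e : z * q ^+ N.+1 = y * q by rewrite exprSr mulrA.
  pose V n := - (coef a n * (1 - q ^+ n) * y ^+ n).
  have cS n : coef a n.+1 * (1 - q ^+ n.+1) = coef a n * (1 - a * q ^+ n).
    have h := qX_neq1 q1 n; have h' := qpoch_qq_neq0 q1 n.
    rewrite /coef !qpochS -exprS; by field; rewrite h h'.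
  have V0 : tends V 0.
    have h := tendsN (tendsM (tendsM (qbinomial_coef_tends q1 a)
      (tendsB (tends_cst 1) (tends_expr q1))) (tends_expr (zX1 N))).
    by rewrite mulr0 oppr0 in h.
  have h1 := hF N; have h2 := hF N.+1; rewrite e in h2.
  have h : tends (series (fun n => (1 - y) * (coef a n * y ^+ n)))
      ((1 - a * y) * F N.+1 + 0).
    apply: (sum_recurrence (u2 := fun=> 0) (T := V)) h2 (tends_near (N := 0) _) => //.
    - move=> n; rewrite /V [(y * q) ^+ n]exprMn subr0.
      rewrite (_ : coef a n.+1 * (1 - q ^+ n.+1) * y ^+ n.+1 =
        coef a n * (1 - a * q ^+ n) * y ^+ n.+1) ?cS // exprS; ring.
    - by rewrite /V expr0 subrr mulr0 mul0r oppr0.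
    - by move=> n _; rewrite /series /= big1.
  rewrite addr0 in h; rewrite -mulrA -/y; apply: (tends_unique _ h).
  apply: eq_tends (tendsZ (1 - y) h1) => n.
  by rewrite /series /= mulr_sumr.
have FN N : qpoch z q N * F 0%N = qpoch (a * z) q N * F N.
  elim: N => [|N IHN]; first by rewrite !qpoch0.
  by rewrite !qpochS mulrAC IHN -[LHS]mulrA -[RHS]mulrA -FS [F N * _]mulrC.
have Flim : tends F 1.
  have h1 : tends (series (fun n => (n == 0)%:R : R[i])) 1.
    apply: (tends_near (N := 1)) => -[//|n] _.
    by rewrite /series /= big_nat_recl //= big1 ?addr0.
  have cB : 0 <= A / (1 - cmod z) by rewrite divr_ge0 // subr_ge0 ltW.
  have lim : (fun N => A / (1 - cmod z) * cmod q ^+ N) @ \oo --> (0 : R).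
    rewrite -[X in _ --> X](mulr0 (A / (1 - cmod z))).
    apply: cvgM; first exact: cvg_cst.
    by apply: cvg_expr; rewrite ger0_norm ?cmod_ge0.
  apply: tends_squeeze lim => N; rewrite mulrAC.
  apply: (series_close _ _ _ (hF N) h1).
  - by rewrite mulr_ge0 // exprn_ge0 // ltW.
  - by rewrite cmod_ge0.
  move=> [|n] /=.
    rewrite /coef !qpoch0 !expr0 invr1 !mulr1 subrr cmod0.
    by rewrite mulr_ge0 // exprn_ge0 // ltW.
  rewrite subr0 cmodM -mulrA ler_pM ?cmod_ge0 ?hA // cmodX cmodM cmodX exprMn mulrC.
  rewrite ler_wpM2r ?exprn_ge0 ?cmod_ge0 // -exprM mulnS exprD ler_piMr ?exprn_ge0 ?(ltW r0) //.
  by rewrite exprn_ile1 ?(ltW r0) ?(ltW r1).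
have h : tends (fun N => qpoch z q N * F 0%N) (qpoch_inf (a * z) q).
  rewrite -[X in tends _ X]mulr1; apply: eq_tends (tendsM (qpoch_tends (a * z) q1) Flim).
  by move=> N; rewrite -FN.
have h' := tendsM (qpoch_tends z q1) (tends_cst (F 0%N)).
have e := tends_unique h h'.
have zn0 : qpoch_inf z q != 0.
  apply: qpoch_inf_neq0 => // j; rewrite subr_eq0 eq_sym; apply/negP => /eqP h2.
  by have := zX1 j; rewrite h2 cmod1 ltxx.
rewrite e mulrC mulKf //.
by apply: eq_tends (hF 0%N) => n; rewrite expr0 mulr1.
Qed.

End QBinomial.

(** * Rate of convergence along (b q^N, c q^N) *)

Section NearOneInstances.
Variables (R : realType) (q l : R[i]).
Hypothesis q1 : cmod q < 1.
Hypothesis q0 : q != 0.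
Implicit Types (b c t z : R[i]) (n m N : nat).

Let q21 : cmod (q ^+ 2) < 1.
Proof. by rewrite cmodX exprn_ilt1 ?cmod_ge0. Qed.

Let q01 : 0 < cmod q < 1.
Proof. by rewrite cmod_gt0 q0 q1. Qed.

Let small z p k N n : cmod p <= 1 ->
  cmod (z * q ^+ N * p ^+ (n + k)) <= cmod z * cmod q ^+ N.
Proof.
move=> p1; rewrite 2!cmodM !cmodX ler_piMr ?mulr_ge0 ?exprn_ge0 ?cmod_ge0 //.
by rewrite exprn_ile1 ?cmod_ge0.
Qed.

Lemma near_one_phi_factor b :
  near_one (cmod q) (fun N n => phi_factor q l (b * q ^+ N) n).
Proof.
have q1' := ltW q1.
apply: near_oneM => //; [apply: near_oneM => //|].
- apply: (@near_one_qpoch _ _ q01 _ (cmod b)); rewrite ?cmod_ge0 // => N n.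
  by rewrite cmodM cmodX.
- apply: (@near_one_qpoch_inf _ _ q01 _ (cmod b)); rewrite ?cmod_ge0 // => N n.
  by have := small b 1 N n q1'; rewrite addn1.
- apply: (@near_one_qpoch_inf _ _ q01 _ (cmod (l ^+ 2 * b))); rewrite ?cmod_ge0 // => N n.
  by have := small (l ^+ 2 * b) 2 N n q1'; rewrite addn2 -[l ^+ 2 * b * _]mulrA.
Qed.

Lemma near_one_W_factor b :
  near_one (cmod q) (fun N n => W_factor q l (b * q ^+ N) n).
Proof.
have q1' := ltW q1.
apply: near_oneM => //.
- apply: (@near_one_qpoch _ _ q01 _ (cmod b)); rewrite ?cmod_ge0 // => N n.
  by rewrite cmodM cmodX.
- apply: (@near_one_qpoch_inf _ _ q01 _ (cmod (l * b))); rewrite ?cmod_ge0 // => N n.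
  by have := small (l * b) 1 N n q1'; rewrite addn1 -[l * b * _]mulrA.
Qed.

Lemma near_one_W_core t :
  near_one (cmod q) (fun N n => W_core q l (t * (q ^+ 2) ^+ N) n).
Proof.
have q1' := ltW q1; have q21' := ltW q21.
have small' z p k N n : cmod p <= 1 ->
    cmod (z * (q ^+ 2) ^+ N * p ^+ (n + k)) <= cmod z * cmod q ^+ N.
  move=> p1; rewrite exprAC expr2 mulrA -mulrA [q ^+ N * _]mulrC mulrA.
  rewrite [cmod _]cmodM cmodX (le_trans (ler_piMr _ _) (small z k N n p1)) ?cmod_ge0 //.
  - by rewrite exprn_ile1 ?cmod_ge0.
have s0 z N : cmod (z * (q ^+ 2) ^+ N) <= cmod z * cmod q ^+ N.
  by have := small' z q 0%N N 0%N q1'; rewrite expr0 mulr1.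
rewrite /W_core; repeat (apply: near_oneM => //).
- apply: (@near_one_qpoch_inf _ _ q01 _ (cmod (t * q))); rewrite ?cmod_ge0 // => N n.
  by rewrite mulrAC.
- by apply: (@near_one_qpoch _ _ q01 _ (cmod t)); rewrite ?cmod_ge0.
- by apply: near_oneV => //; apply: (@near_one_qpoch _ _ q01 _ (cmod t)); rewrite ?cmod_ge0.
- apply: (@near_one_qpoch_inf _ _ q01 _ (cmod (l ^+ 2 * t * q ^+ 2))); rewrite ?cmod_ge0 // => N n.
  have := small' (l ^+ 2 * t * q ^+ 2) (q ^+ 2) 0%N N n q21'; rewrite addn0.
  by rewrite [l ^+ 2 * (t * _)]mulrA [l ^+ 2 * t * _ * q ^+ 2]mulrAC.
- apply: (@near_one_sub _ _ _ (cmod (l * t))); rewrite ?cmod_ge0 // => N n.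
  have := small' (l * t) (q ^+ 2) 0%N N n q21'; rewrite addn0.
  by rewrite [l * (t * _)]mulrA.
- apply: near_oneV => //.
  apply: (@near_one_qpoch_inf _ _ q01 _ (cmod (l * t))); rewrite ?cmod_ge0 // => N n.
  have := small' (l * t) q 0%N N n q1'; rewrite addn0.
  by rewrite [l * (t * _)]mulrA.
Qed.

End NearOneInstances.

(** * The identity between the two single series *)

Section Core.
Variables (R : realType) (q l : R[i]).
Hypothesis q1 : cmod q < 1.
Hypothesis q0 : q != 0.
Implicit Types (b c t z : R[i]) (n m N : nat).

Let q21 : cmod (q ^+ 2) < 1.
Proof. by rewrite cmodX exprn_ilt1 ?cmod_ge0. Qed.

Let q01 : 0 < cmod q < 1.
Proof. by rewrite cmod_gt0 q0 q1. Qed.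

Definition W_const : R[i] :=
  qpoch_inf q (q ^+ 2) * qpoch_inf (q ^+ 2 * l ^+ 2) (q ^+ 2) /
  qpoch_inf (q * l) q.

Lemma qpoch_inf_lt1_neq0 z : cmod z < 1 -> qpoch_inf z q != 0.
Proof.
move=> z1; apply: qpoch_inf_neq0 => // j.
rewrite subr_eq0 eq_sym; apply/negP => /eqP h.
have : cmod (z * q ^+ j) < 1.
  by rewrite cmodM cmodX (le_lt_trans _ z1) // ler_piMr ?cmod_ge0 // exprn_ile1 ?cmod_ge0 // ltW.
by rewrite h cmod1 ltxx.
Qed.

(** Euler: partitions into odd parts and into distinct parts are equinumerous. *)
Lemma euler_odd_distinct : qpoch_inf q (q ^+ 2) * qpoch_inf (- q) q = 1.
Proof.
have h1 := qpoch_inf_sqr q q1.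
have h2 := qpoch_inf_double q q1; rewrite -expr2 in h2.
have h3 : qpoch_inf (q ^+ 2) (q ^+ 2) != 0 by exact: qq_inf_neq0 q21.
move: h1 h2 h3; generalize (qpoch_inf (q ^+ 2) (q ^+ 2)) (qpoch_inf q (q ^+ 2))
  (qpoch_inf (- q) q) (qpoch_inf q q) => X Y Z V h1 h2 h3.
by apply: (mulfI h3); rewrite mulr1 mulrA [X * Y]mulrC -h2 -h1.
Qed.

Lemma W_const_limit : cmod (q * l) < 1 ->
  W_const * (qpoch_inf (q * l * - (q * l)) q / qpoch_inf (- (q * l)) q) =
  qpoch_inf (q * l ^+ 2 * - q) q / qpoch_inf (- q) q.
Proof.
move=> ql1.
have n1 := qpoch_inf_lt1_neq0 ql1.
have n2 : qpoch_inf (- (q * l)) q != 0 by rewrite qpoch_inf_lt1_neq0 // cmodN.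
have n3 : qpoch_inf (- q) q != 0 by rewrite qpoch_inf_lt1_neq0 // cmodN.
have h1 : qpoch_inf (q ^+ 2 * l ^+ 2) (q ^+ 2) =
    qpoch_inf (q * l) q * qpoch_inf (- (q * l)) q.
  by rewrite -qpoch_inf_sqr // exprMn.
have h2 := euler_odd_distinct.
have -> : q * l ^+ 2 * - q = q * l * - (q * l) by ring.
rewrite /W_const h1; move: n1 n2 n3 h2.
generalize (qpoch_inf (q * l * - (q * l)) q) (qpoch_inf (q * l) q)
  (qpoch_inf (- (q * l)) q) (qpoch_inf (- q) q) (qpoch_inf q (q ^+ 2)).
move=> P A B C D A0 B0 C0 DC; have -> : D = C^-1.
  by apply: (mulfI C0); rewrite mulfV // mulrC.
by field; rewrite A0 B0 C0.
Qed.

Definition identity_at b c : Prop := exists S : R[i],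
  tends (series (W_summand q l b c)) S /\
  tends (series (phi_summand q l b c)) (W_const * S).

Lemma identity_at_sym b c : identity_at b c -> identity_at c b.
Proof.
move=> [S [h1 h2]]; exists S; split.
  apply: eq_tends h1 => n; apply: eq_bigr => i _.
  by rewrite /W_summand [c * b]mulrC [W_factor q l c i * _]mulrC.
apply: eq_tends h2 => n; apply: eq_bigr => i _.
by rewrite /phi_summand mulrAC.
Qed.

Lemma W_regularX t N : W_regular q l t -> W_regular q l (t * (q ^+ 2) ^+ N).
Proof.
elim: N => [|N IHN] reg; first by rewrite expr0 mulr1.
by rewrite exprSr mulrA; exact: W_regular_shift (IHN reg).
Qed.

(** The difference of the two sides along (b q^N, c q^N) is a rapidly decreasing
    solution of the q-difference equation. *)
Lemma identity_nonterminating b c :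
  cmod (q * l) < 1 -> W_regular q l (b * c) -> identity_at b c.
Proof.
move=> ql1 reg.
have reg' N : W_regular q l (b * q ^+ N * (c * q ^+ N)).
  have -> : b * q ^+ N * (c * q ^+ N) = b * c * (q ^+ 2) ^+ N.
    by rewrite -exprM mulnC exprM; ring.
  exact: W_regularX.
have [SW hW] : exists S : nat -> R[i],
    forall N, tends (series (W_summand q l (b * q ^+ N) (c * q ^+ N))) (S N).
  have [S hS] := @choice _ _ _ (fun N => W_series_cvg q1 ql1 (reg' N)).
  by exists S.
have [SP hP] : exists S : nat -> R[i],
    forall N, tends (series (phi_summand q l (b * q ^+ N) (c * q ^+ N))) (S N).
  have [S hS] := @choice _ _ _ (fun N => phi_series_cvg l q1 (b * q ^+ N) (c * q ^+ N)).
  by exists S.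
have nql : cmod (- (q * l)) < 1 by rewrite cmodN.
have nq : cmod (- q) < 1 by rewrite cmodN.
have [BW [NW [BW0 dW]]] : exists B : R, exists N0 : nat, 0 <= B /\
    forall N, (N0 <= N)%N -> cmod (SW N - qpoch_inf (q * l * - (q * l)) q /
      qpoch_inf (- (q * l)) q) <= B * cmod q ^+ N.
  have [A hA] := tends_bounded (qbinomial_coef_tends q1 (q * l)).
  apply: (near_one_series q01 (f := fun N n => W_core q l (b * c * (q ^+ 2) ^+ N) n *
    (W_factor q l (b * q ^+ N) n * W_factor q l (c * q ^+ N) n))
    (w := W_weight q l) (A := A) (rho := cmod (- (q * l)))).
  - apply: near_oneM => //; first exact: near_one_W_core.
    by apply: near_oneM => //; exact: near_one_W_factor.
  - by rewrite cmod_ge0.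
  - by move=> n; rewrite /W_weight cmodM cmodX ler_wpM2r ?exprn_ge0 ?cmod_ge0.
  - exact: qbinomial.
  move=> N; apply: eq_tends (hW N) => n; apply: eq_bigr => i _.
  rewrite /W_summand -mulrA.
  have -> : b * q ^+ N * (c * q ^+ N) = b * c * (q ^+ 2) ^+ N.
    by rewrite -exprM mulnC exprM; ring.
  by [].
have [BP [NP [BP0 dP]]] : exists B : R, exists N0 : nat, 0 <= B /\
    forall N, (N0 <= N)%N -> cmod (SP N - qpoch_inf (q * l ^+ 2 * - q) q /
      qpoch_inf (- q) q) <= B * cmod q ^+ N.
  have [A hA] := tends_bounded (qbinomial_coef_tends q1 (q * l ^+ 2)).
  apply: (near_one_series q01 (f := fun N n =>
    phi_factor q l (b * q ^+ N) n * phi_factor q l (c * q ^+ N) n)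
    (w := phi_weight q l) (A := A) (rho := cmod (- q))).
  - by apply: near_oneM => //; exact: near_one_phi_factor.
  - by rewrite cmod_ge0.
  - by move=> n; rewrite /phi_weight cmodM cmodX ler_wpM2r ?exprn_ge0 ?cmod_ge0.
  - exact: qbinomial.
  move=> N; apply: eq_tends (hP N) => n; apply: eq_bigr => i _.
  by rewrite /phi_summand -mulrA.
rewrite -W_const_limit // in dP.
set W0 := qpoch_inf _ _ / _ in dW dP.
pose d N := W_const * SW N - SP N.
have shift1 x N : x * q ^+ N * q = x * q ^+ N.+1 by rewrite exprSr mulrA.
have shift2 x N : x * q ^+ N * q ^+ 2 = x * q ^+ N.+2.
  by rewrite -mulrA -exprD addn2.
pose al N := b * c * q * (q ^+ N) ^+ 2.
pose be N := ((1 - b * q ^+ N.+1) * (1 - c * q ^+ N.+1)) ^+ 2 - 1.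
have dS N : d N = (1 - l ^+ 2 * q) * (1 - al N) * d N.+1 +
    l ^+ 2 * q * (1 + be N) * d N.+2.
  have hP2 := hP N.+2; have hP1 := hP N.+1; rewrite -(shift1 b) -(shift1 c) in hP1.
  rewrite -(shift2 b) -(shift2 c) in hP2.
  have pr := tends_unique (hP N) (phi_recurrence q1 q0 hP1 hP2).
  have hW2 := hW N.+2; have hW1 := hW N.+1; rewrite -(shift1 b) -(shift1 c) in hW1.
  rewrite -(shift2 b) -(shift2 c) in hW2.
  have hW2' : tends (series (fun n => (1 - b * q ^+ N * q) ^+ 2 *
      W_summand q l (b * q ^+ N * q ^+ 2) (c * q ^+ N * q ^+ 2) n))
      ((1 - b * q ^+ N * q) ^+ 2 * SW N.+2).
    by apply: eq_tends (tendsZ _ hW2) => n; rewrite /series /= mulr_sumr.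
  have wr := tends_unique (hW N) (W_recurrence q1 (reg' N)
    (W_antidiff_tends q1 ql1 (reg' N)) hW1 hW2').
  by rewrite /d pr wr /al /be -(shift1 b) -(shift1 c); ring.
have qle1 k : cmod (q ^+ k) <= 1 by rewrite cmodX exprn_ile1 ?cmod_ge0 // ltW.
have qN0 k : 0 <= cmod q ^+ k by rewrite exprn_ge0 // cmod_ge0.
pose A1 := (1 + cmod b) * (1 + cmod c).
have [A [A0 alA beA]] : exists A : R, [/\ 0 <= A,
    forall N, cmod (al N) <= A * cmod q ^+ N &
    forall N, cmod (be N) <= A * cmod q ^+ N].
  have b0 := cmod_ge0 b; have c0 := cmod_ge0 c.
  exists (cmod (b * c * q) + (cmod b + cmod c + cmod b * cmod c) * (A1 + 1)).
  have k0 : 0 <= (cmod b + cmod c + cmod b * cmod c) * (A1 + 1).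
    by rewrite /A1 !(mulr_ge0, addr_ge0).
  split=> [|N|N].
  - by rewrite addr_ge0 ?cmod_ge0.
  - rewrite /al cmodM cmodX cmodX mulrDl -[leLHS]addr0 lerD //; last exact: mulr_ge0.
    by rewrite ler_wpM2l ?cmod_ge0 // expr2 ler_piMl // -cmodX.
  pose x := b * q ^+ N.+1; pose y := c * q ^+ N.+1.
  have xb : cmod x <= cmod b * cmod q ^+ N.
    by rewrite cmodM cmodX ler_wpM2l // exprS ler_piMl // ltW.
  have yc : cmod y <= cmod c * cmod q ^+ N.
    by rewrite cmodM cmodX ler_wpM2l // exprS ler_piMl // ltW.
  have xb1 : cmod x <= cmod b by rewrite (le_trans xb) // ler_piMr // -cmodX.
  have yc1 : cmod y <= cmod c by rewrite (le_trans yc) // ler_piMr // -cmodX.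
  have -> : be N = (x * y - x - y) * ((1 - x) * (1 - y) + 1).
    by rewrite /be /x /y; ring.
  rewrite cmodM [leRHS]mulrDl -[leLHS]add0r lerD ?mulr_ge0 ?cmod_ge0 //.
  rewrite [leRHS]mulrAC ler_pM ?cmod_ge0 //.
    have xy : cmod (x * y) <= cmod b * cmod c * cmod q ^+ N.
      by rewrite cmodM mulrAC ler_pM ?cmod_ge0.
    rewrite (le_trans (cmodB _ _)) //.
    have -> : (cmod b + cmod c + cmod b * cmod c) * cmod q ^+ N =
      cmod b * cmod c * cmod q ^+ N + cmod b * cmod q ^+ N + cmod c * cmod q ^+ N.
      by ring.
    by rewrite lerD // (le_trans (cmodB _ _)) // lerD.
  rewrite (le_trans (cmodD _ _)) // cmod1 lerD // cmodM /A1.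
  by rewrite ler_pM ?cmod_ge0 // (le_trans (cmodB _ _)) // cmod1 lerD.
have K0 := cmod_ge0 W_const.
have mur : cmod (l ^+ 2 * q) * cmod q < 1.
  rewrite -cmodM (_ : l ^+ 2 * q * q = (q * l) ^+ 2); last by ring.
  by rewrite cmodX exprn_ilt1 ?cmod_ge0.
have dB N : (maxn NW NP <= N)%N -> cmod (d N) <= (cmod W_const * BW + BP) * cmod q ^+ N.
  rewrite geq_max => /andP[/dW hw /dP hp].
  have -> : d N = W_const * (SW N - W0) - (SP N - W_const * W0) by rewrite /d; ring.
  by rewrite (le_trans (cmodB _ _)) // mulrDl lerD // cmodM -mulrA ler_wpM2l.
have B0 : 0 <= cmod W_const * BW + BP by rewrite addr_ge0 // mulr_ge0.
have d0 := recurrence_unique q01 A0 B0 mur alA beA dS dB.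
have hP0 := hP 0%N; have hW0 := hW 0%N; rewrite expr0 !mulr1 in hP0 hW0.
exists (SW 0%N); split=> //.
by have -> : W_const * SW 0%N = SP 0%N by apply/eqP; rewrite -subr_eq0 -/(d 0%N) d0.
Qed.

(** Here no bound on l is available: all sums are finite, and the induction goes
    through the pairs (bq, cq) and (bq^2, cq^2), for which N is smaller. *)
Lemma identity_terminating b c N :
  (forall j, 1 - q * l * q ^+ j != 0) ->
  b * q ^+ N = 1 -> W_regular q l (b * c) -> identity_at b c.
Proof.
move=> ql0; elim/ltn_ind: N b c => N IHN b c bN reg.
have [SP hP] := phi_series_cvg l q1 b c.
case: N => [|N] in IHN bN *.
  rewrite expr0 mulr1 in bN; rewrite bN in reg hP *.
  have one0 n : qpoch 1 q n.+1 = 0 :> R[i].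
    by rewrite (@qpoch_eq0 _ 1 q 0) // expr0 mulr1 subrr.
  have sum1 (u : nat -> R[i]) : (forall n, u n.+1 = 0) -> tends (series u) (u 0%N).
    move=> u0; apply: (tends_near (N := 1)) => -[//|n] _.
    by rewrite /series /= big_nat_recl //= big1 ?addr0.
  exists (W_summand q l 1 c 0); split.
    by apply: sum1 => n; rewrite /W_summand /W_factor one0 !mul0r mulr0.
  suff -> : W_const * W_summand q l 1 c 0 = phi_summand q l 1 c 0.
    by apply: sum1 => n; rewrite /phi_summand /phi_factor one0 !(mul0r, mulr0).
  rewrite /W_summand /phi_summand /W_const /W_core /W_factor /phi_factor.
  rewrite /W_weight /phi_weight !qpoch0 !expr0 !invr1 !mul1r !mulr1 !expr1.
  have [h1 h2 h3] := reg; rewrite !mul1r in h1 h2 h3.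
  have e1 : qpoch_inf (l * c) q = (1 - l * c) * qpoch_inf (l * c * q) q.
    exact: qpoch_infS.
  have n1 := qpoch_inf_neq0 q1 h2; have n2 := qpoch_inf_neq0 q1 ql0.
  rewrite e1 in n1 *; move: n1; rewrite mulf_eq0 negb_or => /andP[n1 n3].
  have -> : l * q = q * l by rewrite mulrC.
  have -> : l ^+ 2 * q ^+ 2 = q ^+ 2 * l ^+ 2 by rewrite mulrC.
  move: n1 n2 n3; generalize (qpoch_inf (q * l) q) (qpoch_inf (l * c * q) q)
    (qpoch_inf q (q ^+ 2)) (qpoch_inf (q ^+ 2 * l ^+ 2) (q ^+ 2))
    (qpoch_inf (c * q) (q ^+ 2)) (qpoch_inf (l ^+ 2 * c * q ^+ 2) (q ^+ 2)).
  by move=> A B C D E F n1 n2 n3; field; rewrite n1 n2 n3.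
have reg2 : W_regular q l (b * q * (c * q)).
  have -> : b * q * (c * q) = b * c * q ^+ 2 by ring.
  exact: W_regular_shift.
have reg4 : W_regular q l (b * q ^+ 2 * (c * q ^+ 2)).
  have -> : b * q ^+ 2 * (c * q ^+ 2) = b * q * (c * q) * q ^+ 2 by ring.
  exact: W_regular_shift.
have bN' : b * q * q ^+ N = 1 by rewrite -mulrA -exprS.
have [S1 [hW1 hP1]] := IHN N (leqnn _) (b * q) (c * q) bN' reg2.
have T0 : tends (W_antidiff q l b c) 0.
  have z n : (N < n)%N -> W_factor q l (b * q) n = 0.
    by move=> Nn; rewrite /W_factor (@qpoch_eq0 _ _ _ N) ?bN' ?subrr // mul0r.
  apply: (tends_near (N := N.+2)) => -[//|n] Nn.
  by rewrite /W_antidiff (z n Nn) (z n.+1 (leqW Nn)) !mul0r !mulr0 subr0.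
(* For N = 1 the pair (bq^2, cq^2) is not terminating, but its coefficient
   (1 - bq)^2 is 0. *)
have [S2 [hW2 hP2]] : exists S2, tends (series (fun n => (1 - b * q) ^+ 2 *
      W_summand q l (b * q ^+ 2) (c * q ^+ 2) n)) S2 /\
    tends (series (fun n => (1 - b * q) ^+ 2 *
      phi_summand q l (b * q ^+ 2) (c * q ^+ 2) n)) (W_const * S2).
  case: N => [|N] in IHN bN bN' hW1 hP1 T0 *.
    rewrite expr0 mulr1 in bN'; exists 0; rewrite bN' subrr mulr0; split;
    by apply: (tends_near (N := 0)) => n _; rewrite /series /= big1 // => i _;
      rewrite expr0n mul0r.
  have bN'' : b * q ^+ 2 * q ^+ N = 1 by rewrite expr2 !mulrA -[b * q * q * _]mulrA -exprS.
  have [S [h1 h2]] := IHN N (leqW (leqnn _)) _ _ bN'' reg4.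
  exists ((1 - b * q) ^+ 2 * S); split.
    by apply: eq_tends (tendsZ _ h1) => n; rewrite /series /= mulr_sumr.
  have -> : W_const * ((1 - b * q) ^+ 2 * S) = (1 - b * q) ^+ 2 * (W_const * S).
    by rewrite mulrCA.
  by apply: eq_tends (tendsZ _ h2) => n; rewrite /series /= mulr_sumr.
exists ((1 - l ^+ 2 * q) * (1 - b * c * q) * S1 + l ^+ 2 * q * (1 - c * q) ^+ 2 * S2).
split; first exact: W_recurrence.
have -> : W_const * ((1 - l ^+ 2 * q) * (1 - b * c * q) * S1 +
    l ^+ 2 * q * (1 - c * q) ^+ 2 * S2) =
  (1 - l ^+ 2 * q) * (1 - b * c * q) * (W_const * S1) +
    l ^+ 2 * q * (1 - c * q) ^+ 2 * (W_const * S2) by ring.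
have hP2' := tendsZ (l ^+ 2 * q * (1 - c * q) ^+ 2) hP2.
apply: (sum_recurrence (T := phi_antidiff q l b c)) hP1 _.
- move=> n; exact: phi_telescope.
- by [].
- exact: phi_antidiff_tends.
apply: eq_tends hP2' => n.
by rewrite /series /= mulr_sumr; apply: eq_bigr => i _; rewrite exprMn; ring.
Qed.

End Core.

(** * From basic hypergeometric series to the single series *)

Section HypergeometricSeries.
Variables (R : realType) (q : R[i]).
Hypothesis q1 : cmod q < 1.
Hypothesis q0 : q != 0.
Implicit Types (xs num den : seq R[i]) (x b c l t : R[i]).

Let q21 : cmod (q ^+ 2) < 1.
Proof. by rewrite cmodX exprn_ilt1 ?cmod_ge0. Qed.

Lemma qpochs_tends xs p : cmod p < 1 -> tends (qpochs xs p) (qpochs_inf xs p).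
Proof.
move=> p1; elim: xs => [|x xs IHxs].
  apply: eq_tends (tends_cst _) => n; by rewrite /qpochs /qpochs_inf !big_nil.
rewrite /qpochs_inf big_cons.
by apply: eq_tends (tendsM (qpoch_tends x p1) IHxs) => n; rewrite /qpochs big_cons.
Qed.

Lemma qpochs_inf_neq0 xs p : cmod p < 1 -> no_zero_factor xs p ->
  qpochs_inf xs p != 0.
Proof.
move=> p1 h; rewrite /qpochs_inf prodf_seq_neq0; apply/allP => x xxs /=.
by apply: qpoch_inf_neq0 => //; exact: h.
Qed.

Lemma phi_tends num den p x : cmod p < 1 -> cmod x < 1 ->
  no_zero_factor (p :: den) p ->
  tends (series (phi_term num den p x)) (phi num den p x).
Proof.
move=> p1 x1 h.
have [S hS] : exists S, tends (series (phi_term num den p x)) S.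
  apply: (series_tends_geom x1 (tendsM (qpochs_tends num p1)
    (tendsV (qpochs_inf_neq0 p1 h) (qpochs_tends (p :: den) p1)))).
  by [].
by rewrite /phi (tends_lim hS).
Qed.

(** The terms are differences of consecutive partial sums of the convergent
    series of norms. *)
Lemma phi_term_tends0 num den p x : phi_well_defined num den p x ->
  tends (phi_term num den p x) 0.
Proof.
move=> [_ /cvg_ex[/= L /cvg_tends hL]].
have h := tendsB (tends_shift 1 hL) hL; rewrite subrr in h.
have k : tends (fun n => `|phi_term num den p x n|) 0.
  apply: eq_tends h => n.
  by rewrite addn1 seriesSB.
apply: tends_squeeze k => n; rewrite !subr0 [X in _ <= cmod X]normE.
by rewrite /cmod /= expr0n /= addr0 sqrtr_sqr ler_norm.
Qed.

Variable l : R[i].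

(** Splitting (x;q)_(2n) into the factors with even and with odd exponents turns
    base q into base q^2. *)
Lemma phi_summand_even b c n :
  (forall j, 1 - l ^+ 2 * b * q ^+ 2 * (q ^+ 2) ^+ j != 0) ->
  (forall j, 1 - l ^+ 2 * c * q ^+ 2 * (q ^+ 2) ^+ j != 0) ->
  qpoch_inf (c * q) (q ^+ 2) * qpoch_inf (b * q) (q ^+ 2) *
    qpoch_inf (l ^+ 2 * b * q ^+ 2) (q ^+ 2) *
    qpoch_inf (l ^+ 2 * c * q ^+ 2) (q ^+ 2) *
  (qpoch c (q ^+ 2) n * qpoch b (q ^+ 2) n * qpoch (q * l ^+ 2) (q ^+ 2) n *
    qpoch (q ^+ 2 * l ^+ 2) (q ^+ 2) n /
   (qpoch (q ^+ 2) (q ^+ 2) n * qpoch (l ^+ 2 * b * q ^+ 2) (q ^+ 2) n *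
    qpoch (l ^+ 2 * c * q ^+ 2) (q ^+ 2) n * qpoch q (q ^+ 2) n) *
   (q ^+ 2) ^+ n) = phi_summand q l b c n.*2.
Proof.
move=> hb hc.
rewrite (qpoch_inf_split (c * q) n q21) (qpoch_inf_split (b * q) n q21).
rewrite (qpoch_inf_split (l ^+ 2 * b * q ^+ 2) n q21).
rewrite (qpoch_inf_split (l ^+ 2 * c * q ^+ 2) n q21).
rewrite /phi_summand /phi_weight /phi_factor !qpoch_double.
have e1 d : d * q ^+ n.*2.+1 = d * q * (q ^+ 2) ^+ n.
  by rewrite -exprM mul2n exprS mulrA.
have e2 d : l ^+ 2 * d * q ^+ n.*2.+2 = l ^+ 2 * d * q ^+ 2 * (q ^+ 2) ^+ n.
  by rewrite -exprM mul2n (_ : n.*2.+2 = 2 + n.*2)%N // exprD mulrA.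
rewrite !e1 !e2.
have -> : (- q) ^+ n.*2 = (q ^+ 2) ^+ n by rewrite -mul2n exprM sqrrN.
have -> : q * l ^+ 2 * q = q ^+ 2 * l ^+ 2 by ring.
have -> : q * q = q ^+ 2 by [].
have nb := qpoch_neq0 n hb; have nc := qpoch_neq0 n hc.
have nq : qpoch q (q ^+ 2) n != 0.
  by apply: qpoch_neq0 => j; rewrite -exprM -exprS; exact: qX_neq1.
have nq2 : qpoch (q ^+ 2) (q ^+ 2) n != 0 by exact: qpoch_qq_neq0.
move: nb nc nq nq2.
generalize (qpoch (l ^+ 2 * b * q ^+ 2) (q ^+ 2) n)
  (qpoch (l ^+ 2 * c * q ^+ 2) (q ^+ 2) n) (qpoch q (q ^+ 2) n)
  (qpoch (q ^+ 2) (q ^+ 2) n) (qpoch c (q ^+ 2) n) (qpoch b (q ^+ 2) n)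
  (qpoch (q * l ^+ 2) (q ^+ 2) n) (qpoch (q ^+ 2 * l ^+ 2) (q ^+ 2) n)
  (qpoch (c * q) (q ^+ 2) n) (qpoch (b * q) (q ^+ 2) n)
  (qpoch_inf (c * q * (q ^+ 2) ^+ n) (q ^+ 2))
  (qpoch_inf (b * q * (q ^+ 2) ^+ n) (q ^+ 2))
  (qpoch_inf (l ^+ 2 * c * q ^+ 2 * (q ^+ 2) ^+ n) (q ^+ 2))
  (qpoch_inf (l ^+ 2 * b * q ^+ 2 * (q ^+ 2) ^+ n) (q ^+ 2)) ((q ^+ 2) ^+ n).
move=> x1 x2 x3 x4 x5 x6 x7 x8 x9 x10 x11 x12 x13 x14 x15 n1 n2 n3 n4.
by field; rewrite n1 n2 n3 n4.
Qed.

Lemma phi_summand_odd b c n :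
  (forall j, 1 - l ^+ 2 * b * q ^+ 3 * (q ^+ 2) ^+ j != 0) ->
  (forall j, 1 - l ^+ 2 * c * q ^+ 3 * (q ^+ 2) ^+ j != 0) ->
  - q * ((1 - q * l ^+ 2) / (1 - q)) *
  (qpoch_inf c (q ^+ 2) * qpoch_inf b (q ^+ 2) *
    qpoch_inf (l ^+ 2 * b * q ^+ 3) (q ^+ 2) *
    qpoch_inf (l ^+ 2 * c * q ^+ 3) (q ^+ 2)) *
  (qpoch (c * q) (q ^+ 2) n * qpoch (b * q) (q ^+ 2) n *
    qpoch (q ^+ 2 * l ^+ 2) (q ^+ 2) n * qpoch (q ^+ 3 * l ^+ 2) (q ^+ 2) n /
   (qpoch (q ^+ 2) (q ^+ 2) n * qpoch (l ^+ 2 * b * q ^+ 3) (q ^+ 2) n *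
    qpoch (l ^+ 2 * c * q ^+ 3) (q ^+ 2) n * qpoch (q ^+ 3) (q ^+ 2) n) *
   (q ^+ 2) ^+ n) = phi_summand q l b c n.*2.+1.
Proof.
move=> hb hc.
rewrite (qpoch_inf_split c n.+1 q21) (qpoch_inf_split b n.+1 q21).
rewrite (qpoch_inf_split (l ^+ 2 * b * q ^+ 3) n q21).
rewrite (qpoch_inf_split (l ^+ 2 * c * q ^+ 3) n q21).
rewrite /phi_summand /phi_weight /phi_factor.
rewrite 6!qpochSl !qpoch_double.
have e1 d : d * q ^+ n.*2.+2 = d * (q ^+ 2) ^+ n.+1.
  by rewrite -exprM mul2n doubleS.
have e2 d : l ^+ 2 * d * q ^+ n.*2.+3 = l ^+ 2 * d * q ^+ 3 * (q ^+ 2) ^+ n.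
  by rewrite -exprM mul2n -addn3 addnC exprD mulrA.
rewrite !e1 !e2.
have -> : (- q) ^+ n.*2.+1 = - q * (q ^+ 2) ^+ n.
  by rewrite exprS -mul2n exprM sqrrN.
have -> : q * l ^+ 2 * q * q = q ^+ 3 * l ^+ 2 by ring.
have -> : q * l ^+ 2 * q = q ^+ 2 * l ^+ 2 by ring.
have -> : q * q * q = q ^+ 3 by ring.
have -> : q * q = q ^+ 2 by [].
have -> : b * q * q = b * q ^+ 2 by ring.
have -> : c * q * q = c * q ^+ 2 by ring.
have nb := qpoch_neq0 n hb; have nc := qpoch_neq0 n hc.
have nq : qpoch (q ^+ 3) (q ^+ 2) n != 0.
  by apply: qpoch_neq0 => j; rewrite -exprM -exprD; exact: (@qX_neq1 _ _ q1 (2 + 2 * j)).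
have nq2 : qpoch (q ^+ 2) (q ^+ 2) n != 0 by exact: qpoch_qq_neq0.
have n1q : 1 - q != 0 by exact: (@qX_neq1 _ _ q1 0).
move: nb nc nq nq2.
generalize (qpoch (l ^+ 2 * b * q ^+ 3) (q ^+ 2) n)
  (qpoch (l ^+ 2 * c * q ^+ 3) (q ^+ 2) n) (qpoch (q ^+ 3) (q ^+ 2) n)
  (qpoch (q ^+ 2) (q ^+ 2) n) (qpoch (c * q ^+ 2) (q ^+ 2) n) (qpoch (b * q ^+ 2) (q ^+ 2) n)
  (qpoch (q ^+ 3 * l ^+ 2) (q ^+ 2) n) (qpoch (q ^+ 2 * l ^+ 2) (q ^+ 2) n)
  (qpoch (c * q) (q ^+ 2) n) (qpoch (b * q) (q ^+ 2) n)
  (qpoch_inf (c * (q ^+ 2) ^+ n.+1) (q ^+ 2))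
  (qpoch_inf (b * (q ^+ 2) ^+ n.+1) (q ^+ 2))
  (qpoch_inf (l ^+ 2 * c * q ^+ 3 * (q ^+ 2) ^+ n) (q ^+ 2))
  (qpoch_inf (l ^+ 2 * b * q ^+ 3 * (q ^+ 2) ^+ n) (q ^+ 2)) ((q ^+ 2) ^+ n).
move=> x1 x2 x3 x4 x5 x6 x7 x8 x9 x10 x11 x12 x13 x14 x15 n1 n2 n3 n4.
by field; rewrite n1q n1 n2 n3 n4.
Qed.

(** The quotient of the prefactor of the very-well-poised series by [W_const].
    The latter may vanish, when l q^(j+1) = -1 for some j, whereas this quotient
    is invertible and so transports convergence between the two series. *)
Definition W_prefactor b c : R[i] :=
  qpoch_inf (l * b * q) q * qpoch_inf (l * c * q) q *
  qpoch_inf (b * c * q) (q ^+ 2) *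
  qpoch_inf (l ^+ 2 * (b * c) * q ^+ 2) (q ^+ 2) / qpoch_inf (l * (b * c) * q) q.

Lemma W_summandE b c n : W_regular q l (b * c) ->
  (forall j, 1 - l * b * q * q ^+ j != 0) ->
  (forall j, 1 - l * c * q * q ^+ j != 0) ->
  W_prefactor b c *
  (qpoch (l * (b * c)) q n * qpoch (q ^+ 2 * (l * (b * c))) (q ^+ 2) n *
    qpoch c q n * qpoch b q n * qpoch (q * l) q n * qpoch (b * c) (q ^+ 2) n /
   (qpoch q q n * qpoch (l * (b * c)) (q ^+ 2) n * qpoch (l * b * q) q n *
    qpoch (l * c * q) q n * qpoch (b * c) q n *
    qpoch (l ^+ 2 * (b * c) * q ^+ 2) (q ^+ 2) n) * (- (q * l)) ^+ n) =
  W_summand q l b c n.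
Proof.
move=> [h1 h2 h3] hb hc.
rewrite /W_prefactor (qpoch_inf_split (l * b * q) n q1) (qpoch_inf_split (l * c * q) n q1).
rewrite (qpoch_inf_split (l ^+ 2 * (b * c) * q ^+ 2) n q21).
rewrite /W_summand /W_weight /W_core /W_factor.
have e1 d : l * d * q ^+ n.+1 = l * d * q * q ^+ n by rewrite exprS mulrA.
rewrite !e1.
set k := l * (b * c) in h2 *; set t := b * c in h1 h3 *.
have k1 : 1 - k != 0 by have := h2 0%N; rewrite expr0 mulr1.
have kq : qpoch_inf (k * q) q != 0.
  by apply: qpoch_inf_neq0 => // j; have := h2 j.+1; rewrite exprS mulrA.
have kqn : qpoch_inf (k * q ^+ n) q != 0.
  by apply: qpoch_inf_neq0 => // j; have := h2 (n + j)%N; rewrite exprD mulrA.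
have knk := qpoch_inf_split k n q1; rewrite (qpoch_infS k q1) in knk.
have k2 : (1 - k) * qpoch (q ^+ 2 * k) (q ^+ 2) n =
    qpoch k (q ^+ 2) n * (1 - k * (q ^+ 2) ^+ n).
  by rewrite [q ^+ 2 * k]mulrC -qpochSl qpochS.
have nk2 : qpoch k (q ^+ 2) n != 0.
  by apply: qpoch_neq0 => j; rewrite -exprM; exact: h2.
have nt := qpoch_neq0 n h1.
have nb := qpoch_neq0 n hb; have nc := qpoch_neq0 n hc.
have na := qpoch_neq0 n h3; have nq := qpoch_qq_neq0 q1 n.
have -> : qpoch (q ^+ 2 * k) (q ^+ 2) n =
    qpoch k (q ^+ 2) n * (1 - k * (q ^+ 2) ^+ n) / (1 - k) 
  by rewrite -k2 [(1 - k) * _]mulrC mulfK.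
have -> : qpoch k q n = (1 - k) * qpoch_inf (k * q) q / qpoch_inf (k * q ^+ n) q.
  by rewrite knk mulfK.
move: k1 kq kqn nk2 nt nb nc na nq.
generalize (qpoch_inf (k * q) q) (qpoch_inf (k * q ^+ n) q) (qpoch k (q ^+ 2) n)
  (qpoch t q n) (qpoch (l * b * q) q n) (qpoch (l * c * q) q n)
  (qpoch (l ^+ 2 * t * q ^+ 2) (q ^+ 2) n) (qpoch q q n)
  (qpoch c q n) (qpoch b q n) (qpoch (q * l) q n) (qpoch t (q ^+ 2) n)
  (qpoch_inf (l * b * q * q ^+ n) q) (qpoch_inf (l * c * q * q ^+ n) q)
  (qpoch_inf (t * q) (q ^+ 2))
  (qpoch_inf (l ^+ 2 * t * q ^+ 2 * (q ^+ 2) ^+ n) (q ^+ 2))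
  ((- (q * l)) ^+ n) ((q ^+ 2) ^+ n).
move=> x1 x2 x3 x4 x5 x6 x7 x8 x9 x10 x11 x12 x13 x14 x15 x16 x17 x18.
move=> n1 n2 n3 n4 n5 n6 n7 n8 n9.
by field; rewrite n1 n2 n3 n4 n5 n6 n7 n8 n9.
Qed.

End HypergeometricSeries.

Section WSeries.
Variables (R : realType) (q l b c s p : R[i]).
Hypothesis q1 : cmod q < 1.
Hypotheses (q0 : q != 0) (l0 : l != 0) (b0 : b != 0) (c0 : c != 0).

Let q21 : cmod (q ^+ 2) < 1.
Proof. by rewrite cmodX exprn_ilt1 ?cmod_ge0. Qed.
Let k : R[i] := l * (b * c).
Hypotheses (sE : s ^+ 2 = k) (pE : p ^+ 2 = b * c).

Let num := W_num k s [:: c; b; q * l; p; - p] q.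
Let den := W_den k s [:: c; b; q * l; p; - p] q.

Lemma W_denE : q :: den = [:: q; s; - s; l * b * q; l * c * q; b * c;
  l * p * q; - (l * p * q)].
Proof.
have p0 : p != 0.
  have : p ^+ 2 != 0 by rewrite pE mulf_neq0.
  by rewrite expf_eq0.
rewrite /den /W_den /= /k.
have -> : l * (b * c) * q / c = l * b * q by field.
have -> : l * (b * c) * q / b = l * c * q by field.
have -> : l * (b * c) * q / (q * l) = b * c by field; rewrite q0 l0.
have e : l * (b * c) * q / p = l * p * q by rewrite -pE; field.
by rewrite e invrN mulrN e.
Qed.

Hypothesis den_neq0 : no_zero_factor (q :: den) q.
Hypothesis kq_neq0 : forall j, 1 - k * q * q ^+ j != 0.

Let mul_conj (x y : R[i]) : (1 - x * y) * (1 - - x * y) = 1 - x ^+ 2 * y ^+ 2.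
Proof. by ring. Qed.

Lemma W_den_factors : [/\ forall j, 1 - s * q ^+ j != 0,
  forall j, 1 - - s * q ^+ j != 0, forall j, 1 - l * b * q * q ^+ j != 0 &
  forall j, 1 - l * c * q * q ^+ j != 0].
Proof.
by split=> j; apply: den_neq0; rewrite W_denE !inE eqxx ?orbT.
Qed.

(** Products of factors at opposite parameters, (1 - x)(1 + x) = 1 - x^2, give the
    conditions at k and at l^2 t q^2; the remaining ones for k come from the
    prefactor. *)
Lemma W_den_regular : W_regular q l (b * c).
Proof.
have [hs hs' _ _] := W_den_factors.
split=> j.
- by apply: den_neq0; rewrite W_denE !inE eqxx ?orbT.
- case: j => [|j]; last by have := kq_neq0 j; rewrite exprS mulrA.
  by have := mulf_neq0 (hs 0%N) (hs' 0%N); rewrite mul_conj sE !expr0 expr1n.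
have h1 : 1 - l * p * q * q ^+ j != 0.
  by apply: den_neq0; rewrite W_denE !inE eqxx ?orbT.
have h2 : 1 - - (l * p * q) * q ^+ j != 0.
  by apply: den_neq0; rewrite W_denE !inE eqxx ?orbT.
have := mulf_neq0 h1 h2; rewrite mul_conj exprAC.
by rewrite (_ : (l * p * q) ^+ 2 = l ^+ 2 * (b * c) * q ^+ 2) // -pE; ring.
Qed.

Lemma W_termE n x : phi_term num den q x n =
  qpoch k q n * qpoch (q ^+ 2 * k) (q ^+ 2) n *
    qpoch c q n * qpoch b q n * qpoch (q * l) q n * qpoch (b * c) (q ^+ 2) n /
   (qpoch q q n * qpoch k (q ^+ 2) n * qpoch (l * b * q) q n *
    qpoch (l * c * q) q n * qpoch (b * c) q n *
    qpoch (l ^+ 2 * (b * c) * q ^+ 2) (q ^+ 2) n) * x ^+ n.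
Proof.
have F1 : qpoch (q ^+ 2 * k) (q ^+ 2) n =
    qpoch (q * s) q n * qpoch (- (q * s)) q n by rewrite -qpoch_sqr exprMn sE.
have F2 : qpoch k (q ^+ 2) n = qpoch s q n * qpoch (- s) q n.
  by rewrite -qpoch_sqr sE.
have F3 : qpoch (b * c) (q ^+ 2) n = qpoch p q n * qpoch (- p) q n.
  by rewrite -qpoch_sqr pE.
have F4 : qpoch (l ^+ 2 * (b * c) * q ^+ 2) (q ^+ 2) n =
    qpoch (l * p * q) q n * qpoch (- (l * p * q)) q n.
  by rewrite -qpoch_sqr !exprMn pE.
rewrite F1 F2 F3 F4 /phi_term W_denE /qpochs /num /W_num !big_cons !big_nil.
congr (_ * _); congr (_ / _); by rewrite !mulrA mulr1.
Qed.

Lemma W_prefactor_neq0 : W_prefactor q l b c != 0.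
Proof.
have [_ _ hb hc] := W_den_factors; have [h1 h2 h3] := W_den_regular.
have n1 := qpoch_inf_neq0 q1 hb; have n2 := qpoch_inf_neq0 q1 hc.
have n3 := qpoch_inf_neq0 q21 h3; have n4 := qpoch_inf_neq0 q1 kq_neq0.
have n5 : qpoch_inf (b * c * q) (q ^+ 2) != 0.
  by apply: qpoch_inf_neq0 => // j; rewrite -exprM -mulrA -exprS.
apply: mulf_neq0; last by rewrite invr_eq0; exact: n4.
apply: (mulf_neq0 _ n3); apply: (mulf_neq0 _ n5); exact: mulf_neq0 n1 n2.
Qed.

Lemma W_prefactor_term n :
  W_prefactor q l b c * phi_term num den q (- (q * l)) n = W_summand q l b c n.
Proof.
have [_ _ hb hc] := W_den_factors.
by rewrite W_termE (W_summandE q1 _ W_den_regular hb hc).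
Qed.

(** If the series does not terminate and |q l| >= 1, its terms cannot tend to 0:
    divided by (-q l)^n, they have a nonzero limit. *)
Lemma identity_of_W_convergence :
  (forall j, 1 - q * l * q ^+ j != 0) ->
  phi_well_defined num den q (- (q * l)) -> identity_at q l b c.
Proof.
move=> ql0 wd; have reg := W_den_regular.
case: (pselect (exists j, b * q ^+ j = 1)) => [[j bj]|nb].
  exact: identity_terminating bj reg.
case: (pselect (exists j, c * q ^+ j = 1)) => [[j cj]|nc].
  apply: identity_at_sym; apply: identity_terminating cj _ => //.
  by rewrite [c * b]mulrC.
apply: identity_nonterminating => //; rewrite ltNge; apply/negP => ql1.
have [u [uE ulim]] := W_summand_tends q1 reg.
have := phi_term_tends0 wd => t0.
have u0 : tends u 0.
  have h := tendsZ (W_prefactor q l b c) t0; rewrite mulr0 in h.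
  apply: tends_squeeze h => n; rewrite !subr0 W_prefactor_term uE cmodM.
  by rewrite ler_peMr ?cmod_ge0 // cmodX cmodN exprn_ege1.
have := tends_unique ulim u0; apply/eqP.
have [h1 h2 h3] := reg.
have nf x : ~ (exists j, x * q ^+ j = 1) -> qpoch_inf x q != 0.
  move=> nx; apply: qpoch_inf_neq0 => // j; rewrite subr_eq0 eq_sym.
  by apply/negP => /eqP h; apply: nx; exists j.
have m1 := qpoch_inf_neq0 q1 ql0; have m2 := qq_inf_neq0 q1.
have m3 : qpoch_inf (b * c * q) (q ^+ 2) != 0.
  by apply: qpoch_inf_neq0 => // j; rewrite -exprM -mulrA -exprS.
have m4 : qpoch_inf (b * c) (q ^+ 2) != 0.
  by apply: qpoch_inf_neq0 => // j; rewrite -exprM.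
have m5 := qpoch_inf_neq0 q1 h1.
apply: mulf_neq0; last exact: mulf_neq0 (nf _ nb) (nf _ nc).
apply: mulf_neq0; first by apply: (mulf_neq0 m1); rewrite invr_eq0; exact: m2.
by apply: (mulf_neq0 (mulf_neq0 m3 m4)); rewrite invr_eq0; exact: m5.
Qed.

Lemma W_value S : tends (series (W_summand q l b c)) S ->
  W k s [:: c; b; q * l; p; - p] q (- (q * l)) = S / W_prefactor q l b c.
Proof.
move=> hS; rewrite /W /phi; apply: tends_lim.
have n0 := W_prefactor_neq0.
rewrite [S / _]mulrC; apply: eq_tends (tendsZ (W_prefactor q l b c)^-1 hS) => n.
rewrite /series /= mulr_sumr; apply: eq_bigr => i _.
by rewrite -W_prefactor_term mulKf.
Qed.

End WSeries.

Section PhiSeries.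
Variables (R : realType) (q l b c : R[i]).
Hypothesis q1 : cmod q < 1.
Hypothesis q0 : q != 0.

Lemma series_double (u : nat -> R[i]) n :
  series u n.*2 = series (fun k => u k.*2) n + series (fun k => u k.*2.+1) n.
Proof.
elim: n => [|n IHn]; first by rewrite /series /= !big_geq // addr0.
by rewrite doubleS !seriesSr IHn; ring.
Qed.

Lemma phi_value T :
  let den1 := [:: l ^+ 2 * b * q ^+ 2; l ^+ 2 * c * q ^+ 2; q] in
  let den2 := [:: l ^+ 2 * b * q ^+ 3; l ^+ 2 * c * q ^+ 3; q ^+ 3] in
  no_zero_factor (q ^+ 2 :: den1) (q ^+ 2) ->
  no_zero_factor (q ^+ 2 :: den2) (q ^+ 2) ->
  tends (series (phi_summand q l b c)) T ->
  T = qpochs_inf [:: c * q; b * q; l ^+ 2 * b * q ^+ 2; l ^+ 2 * c * q ^+ 2]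
        (q ^+ 2) *
      phi [:: c; b; q * l ^+ 2; q ^+ 2 * l ^+ 2] den1 (q ^+ 2) (q ^+ 2)
      - q * ((1 - q * l ^+ 2) / (1 - q)) *
        qpochs_inf [:: c; b; l ^+ 2 * b * q ^+ 3; l ^+ 2 * c * q ^+ 3] (q ^+ 2) *
        phi [:: c * q; b * q; q ^+ 2 * l ^+ 2; q ^+ 3 * l ^+ 2] den2
          (q ^+ 2) (q ^+ 2).
Proof.
move=> den1 den2 hd1 hd2 hT.
have q21 : cmod (q ^+ 2) < 1 by rewrite cmodX exprn_ilt1 ?cmod_ge0.
have t1 := phi_tends [:: c; b; q * l ^+ 2; q ^+ 2 * l ^+ 2] q21 q21 hd1.
have t2 := phi_tends [:: c * q; b * q; q ^+ 2 * l ^+ 2; q ^+ 3 * l ^+ 2] q21 q21 hd2.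
have hb1 j : 1 - l ^+ 2 * b * q ^+ 2 * (q ^+ 2) ^+ j != 0.
  by apply: hd1; rewrite !inE eqxx ?orbT.
have hc1 j : 1 - l ^+ 2 * c * q ^+ 2 * (q ^+ 2) ^+ j != 0.
  by apply: hd1; rewrite !inE eqxx ?orbT.
have hb2 j : 1 - l ^+ 2 * b * q ^+ 3 * (q ^+ 2) ^+ j != 0.
  by apply: hd2; rewrite !inE eqxx ?orbT.
have hc2 j : 1 - l ^+ 2 * c * q ^+ 3 * (q ^+ 2) ^+ j != 0.
  by apply: hd2; rewrite !inE eqxx ?orbT.
set A := qpochs_inf _ _; set B := qpochs_inf [:: c; b; _; _] _.
set P1 := phi _ den1 _ _ in t1 *; set P2 := phi _ den2 _ _ in t2 *.
have h : tends (fun n => series (phi_summand q l b c) n.*2)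
    (A * P1 + - q * ((1 - q * l ^+ 2) / (1 - q)) * B * P2).
  apply: eq_tends (tendsD (tendsZ A t1)
    (tendsZ (- q * ((1 - q * l ^+ 2) / (1 - q)) * B) t2)) => n.
  rewrite series_double /series /= !mulr_sumr.
  congr (_ + _); apply: eq_bigr => i _.
    rewrite -(phi_summand_even q1 _ hb1 hc1) /phi_term /qpochs.
    by rewrite /A /qpochs_inf !big_cons !big_nil !mulr1 !mulrA.
  rewrite -(phi_summand_odd q1 _ hb2 hc2) /phi_term /qpochs.
  by rewrite /B /qpochs_inf !big_cons !big_nil !mulr1 !mulrA.
have hT2 : tends (fun n => series (phi_summand q l b c) n.*2) T.
  have /tendsP hT' := hT; apply/tendsP => e /hT'[N hN]; exists N => n Nn.
  by apply: hN; rewrite (leq_trans Nn) // -addnn leq_addr.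
by rewrite (tends_unique hT2 h) !mulNr.
Qed.

End PhiSeries.

Lemma lhs_prefactorE (R : realType) (q l b c : R[i]) :
  qpochs_inf [:: l * b * q; l * c * q] q *
  qpochs_inf [:: q; b * c * q; l ^+ 2 * (b * c) * q ^+ 2; q ^+ 2 * l ^+ 2] (q ^+ 2) /
  qpochs_inf [:: l * (b * c) * q; q * l] q = W_const q l * W_prefactor q l b c.
Proof.
rewrite /qpochs_inf !big_cons !big_nil /W_const /W_prefactor.
generalize (qpoch_inf (l * b * q) q) (qpoch_inf (l * c * q) q)
  (qpoch_inf q (q ^+ 2)) (qpoch_inf (b * c * q) (q ^+ 2))
  (qpoch_inf (l ^+ 2 * (b * c) * q ^+ 2) (q ^+ 2))
  (qpoch_inf (q ^+ 2 * l ^+ 2) (q ^+ 2)) (qpoch_inf (l * (b * c) * q) q)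
  (qpoch_inf (q * l) q) => x1 x2 x3 x4 x5 x6 x7 x8.
by rewrite !invfM invr1; ring.
Qed.

Theorem corollary6 (R : realType) (q a b k sqrt_k sqrt_a : R[i])
  (q_neq0 : q != 0) (a_neq0 : a != 0) (b_neq0 : b != 0) (k_neq0 : k != 0)
  (q_lt1 : `|q| < 1)
  (sqrt_kE : sqrt_k ^+ 2 = k) (sqrt_aE : sqrt_a ^+ 2 = a)
  (prefactor_den : no_zero_factor [:: k * q; q * a / k] q)
  (W_wd : W_well_defined k sqrt_k
     [:: k ^+ 2 / (a * b); b; q * a / k; k / sqrt_a; - k / sqrt_a]
     q (- (q * a) / k))
  (phi1_wd : phi_well_defined
     [:: k ^+ 2 / (a * b); b; q * a ^+ 2 / k ^+ 2; q ^+ 2 * a ^+ 2 / k ^+ 2]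
     [:: q ^+ 2 * a ^+ 2 * b / k ^+ 2; q ^+ 2 * a / b; q]
     (q ^+ 2) (q ^+ 2))
  (phi2_wd : phi_well_defined
     [:: k ^+ 2 * q / (a * b); b * q; q ^+ 2 * a ^+ 2 / k ^+ 2;
         q ^+ 3 * a ^+ 2 / k ^+ 2]
     [:: q ^+ 3 * a ^+ 2 * b / k ^+ 2; q ^+ 3 * a / b; q ^+ 3]
     (q ^+ 2) (q ^+ 2)) :
  qpochs_inf [:: q * a * b / k; k * q / b] q *
  qpochs_inf [:: q; k ^+ 2 * q / a; q ^+ 2 * a; q ^+ 2 * a ^+ 2 / k ^+ 2]
    (q ^+ 2) /
  qpochs_inf [:: k * q; q * a / k] q *
  W k sqrt_k
    [:: k ^+ 2 / (a * b); b; q * a / k; k / sqrt_a; - k / sqrt_a]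
    q (- (q * a) / k)
  =
  qpochs_inf [:: k ^+ 2 * q / (a * b); b * q; a ^+ 2 * b * q ^+ 2 / k ^+ 2;
                 q ^+ 2 * a / b] (q ^+ 2) *
  phi
    [:: k ^+ 2 / (a * b); b; q * a ^+ 2 / k ^+ 2; q ^+ 2 * a ^+ 2 / k ^+ 2]
    [:: q ^+ 2 * a ^+ 2 * b / k ^+ 2; q ^+ 2 * a / b; q]
    (q ^+ 2) (q ^+ 2)
  - q * ((1 - q * a ^+ 2 / k ^+ 2) / (1 - q)) *
    qpochs_inf [:: k ^+ 2 / (a * b); b; a ^+ 2 * b * q ^+ 3 / k ^+ 2;
                   q ^+ 3 * a / b] (q ^+ 2) *
    phi
      [:: k ^+ 2 * q / (a * b); b * q; q ^+ 2 * a ^+ 2 / k ^+ 2;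
          q ^+ 3 * a ^+ 2 / k ^+ 2]
      [:: q ^+ 3 * a ^+ 2 * b / k ^+ 2; q ^+ 3 * a / b; q ^+ 3]
      (q ^+ 2) (q ^+ 2).
Proof.
have q1 : cmod q < 1 by rewrite -cmod_lt1.
have [l lE] : exists l : R[i], l = a / k by exists (a / k).
have [c cE] : exists c : R[i], c = k ^+ 2 / (a * b) by exists (k ^+ 2 / (a * b)).
have l0 : l != 0 by rewrite lE mulf_neq0 ?invr_eq0.
have c0 : c != 0 by rewrite cE mulf_neq0 ?invr_eq0 ?mulf_neq0 ?expf_neq0.
have kE : k = l * (b * c) by rewrite lE cE; field; rewrite k_neq0 b_neq0 a_neq0.
have aE : a = l ^+ 2 * (b * c) by rewrite lE cE; field; rewrite k_neq0 b_neq0 a_neq0.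
have p2 : k * q / b = l * c * q by rewrite kE; field.
have p4 : q * a / k = q * l by rewrite kE aE; field; rewrite b_neq0 c0 l0.
have p5 : - (q * a) / k = - (q * l) by rewrite kE aE; field; rewrite b_neq0 c0 l0.
have p6 : q * a ^+ 2 / k ^+ 2 = q * l ^+ 2.
  by rewrite kE aE; field; rewrite b_neq0 c0 l0.
have p7 : q ^+ 2 * a ^+ 2 / k ^+ 2 = q ^+ 2 * l ^+ 2.
  by rewrite kE aE; field; rewrite b_neq0 c0 l0.
have p8 : q ^+ 2 * a ^+ 2 * b / k ^+ 2 = l ^+ 2 * b * q ^+ 2.
  by rewrite kE aE; field; rewrite b_neq0 c0 l0.
have p9 : q ^+ 2 * a / b = l ^+ 2 * c * q ^+ 2 by rewrite aE; field.
have p10 : k ^+ 2 * q / (a * b) = c * q by rewrite mulrAC -cE.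
have p11 : q ^+ 3 * a ^+ 2 / k ^+ 2 = q ^+ 3 * l ^+ 2.
  by rewrite kE aE; field; rewrite b_neq0 c0 l0.
have p12 : q ^+ 3 * a ^+ 2 * b / k ^+ 2 = l ^+ 2 * b * q ^+ 3.
  by rewrite kE aE; field; rewrite b_neq0 c0 l0.
have p13 : q ^+ 3 * a / b = l ^+ 2 * c * q ^+ 3 by rewrite aE; field.
have p14 : q * a * b / k = l * b * q.
  by rewrite kE aE; field; rewrite b_neq0 c0 l0.
have p15 : k ^+ 2 * q / a = b * c * q.
  by rewrite kE aE; field; rewrite b_neq0 c0 l0.
have p16 : q ^+ 2 * a = l ^+ 2 * (b * c) * q ^+ 2 by rewrite aE; ring.
have p17 : a ^+ 2 * b * q ^+ 2 / k ^+ 2 = l ^+ 2 * b * q ^+ 2.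
  by rewrite kE aE; field; rewrite b_neq0 c0 l0.
have p18 : a ^+ 2 * b * q ^+ 3 / k ^+ 2 = l ^+ 2 * b * q ^+ 3.
  by rewrite kE aE; field; rewrite b_neq0 c0 l0.
have p19 : - k / sqrt_a = - (k / sqrt_a) by rewrite mulNr.
have pE : (k / sqrt_a) ^+ 2 = b * c.
  by rewrite exprMn exprVn sqrt_aE kE aE; field; rewrite b_neq0 c0 l0.
rewrite p4 p5 p19 -cE in prefactor_den W_wd *.
rewrite p6 p7 p8 p9 -cE in phi1_wd *.
rewrite p7 p10 p11 p12 p13 in phi2_wd *.
rewrite p2 p14 p15 p16 p17 p18.
move: (k / sqrt_a) pE W_wd => p pE W_wd.
rewrite kE in sqrt_kE W_wd prefactor_den *.
have kq0 j : 1 - l * (b * c) * q * q ^+ j != 0.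
  by apply: prefactor_den; rewrite !inE eqxx.
have ql0 j : 1 - q * l * q ^+ j != 0.
  by apply: prefactor_den; rewrite !inE eqxx orbT.
have [den_neq0 _] := W_wd.
have [S [hW hphi]] := identity_of_W_convergence q1 q_neq0 l0 b_neq0 c0 sqrt_kE pE
  den_neq0 kq0 ql0 W_wd.
rewrite (W_value q1 q_neq0 l0 b_neq0 c0 sqrt_kE pE den_neq0 kq0 hW).
have [phi1_den _] := phi1_wd; have [phi2_den _] := phi2_wd.
rewrite -(phi_value q1 phi1_den phi2_den hphi).
have n0 := W_prefactor_neq0 q1 q_neq0 l0 b_neq0 c0 sqrt_kE pE den_neq0 kq0.
rewrite lhs_prefactorE.
by rewrite -mulrA [X in _ * X]mulrC (divfK n0).
Qed.
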